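(* Consider the translationally invariant product state $\ket\Psi=\ket\psi^{\otimes N}$ on the cubic lattice $\Lambda=\mathbb Z_L^D$ ($N=L^D$) evolving under a strictly local, uniformly bounded and translationally invariant Hamiltonian $H$, $U_t=e^{-itH}$. Define $$k(t)=-\log\big(\bra\Psi\rho_x(t)\otimes\mathbf 1\ket\Psi\big),$$ where $\rho_x(t)=\mathrm{Tr}_{\{x\}^c}[U_t\ket\Psi\bra\Psi U_t^\dagger]$ is the reduced density matrix of an arbitrary site $x$ at time $t$. If $\ket\Psi$ is not an eigenstate of $H$, then for any $\delta>0$ there exists a time $0<\tau<\delta$ such that $k(\tau)>0$. For any such fixed time $\tau$ and for large enough $L$, we have $$F(\tau)^2\le\mathcal O\Big(\exp\Big(-\tfrac14\big[L^Dk(\tau)\big]^{1/(1+D)}\Big)\Big),$$ where $F(\tau)=|\bra\Psi e^{-i\tau H}\ket\Psi|$ and the constant implied by $\mathcal O$ does not depend on $L$.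
   Context: Each site of $\Lambda$ carries a $d$-dimensional Hilbert space and $\ket\psi\in\mathbb C^d$ is a fixed unit vector. The Hamiltonian is $H=\sum_{x\in\Lambda}h_x$ with each $h_x$ supported on at most $b$ neighbouring sites (''strictly local'') and $\|h_x\|\le h$ (''uniformly bounded''), with the terms $h_x$ being translates of one another; $d,D,b,h$ and the local term do not depend on $L$. By translation invariance $k(t)$ does not depend on the choice of $x$. $\mathbf 1$ denotes the identity on all sites other than $x$, so $\bra\Psi\rho_x(t)\otimes\mathbf 1\ket\Psi=\bra\psi\rho_x(t)\ket\psi$. log is the natural logarithm and $\hbar=1$. *)

(* Defs.v *)
From HB Require Import structures.
From mathcomp Require Import all_boot all_order all_algebra.
From mathcomp Require Import all_classical all_reals all_analysis.
From mathcomp Require Import complex spectral.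

Set Implicit Arguments.
Unset Strict Implicit.
Unset Printing Implicit Defensive.

Import Order.TTheory GRing.Theory Num.Theory.
Import numFieldNormedType.Exports.

Local Open Scope ring_scope.
Local Open Scope classical_set_scope.
Local Open Scope complex_scope.
Local Open Scope sesquilinear_scope.

(* The discrete torus (Z/L)^D. For 0 < L the type 'I_L.-1.+1 is the cyclic
   group of order L, also at L = 1 (where 'Z_L would be Z/2); 'I_L itself
   carries no group structure. *)
Notation torus D L := {ffun 'I_D -> 'I_L.-1.+1}.

Notation lattice D := {ffun 'I_D -> int}.

Definition shift (D L : nat) (x : torus D L) (v : lattice D) : torus D L :=
  [ffun j => x j + Zp1 *~ v j].

(* A finite set of m lattice sites is given by enumerating it as
   s : 'I_m -> lattice D. *)
Definition nearest_neighbours (D : nat) (v w : lattice D) : bool :=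
  (\sum_(j < D) `|v j - w j|)%N == 1%N.

Definition connected_cluster (D m : nat) (s : 'I_m -> lattice D) : Prop :=
  forall i j : 'I_m, connect (fun k l => nearest_neighbours (s k) (s l)) i j.

(* The torus is large enough for the cluster s not to overlap itself when
   wrapped around. For a connected cluster of distinct sites, this holds
   whenever 0 < L and m <= L. *)
Definition fits (D m L : nat) (s : 'I_m -> lattice D) : Prop :=
  (0 < L)%N /\ injective (fun i => shift (0 : torus D L) (s i)).

(* Stated over a generic numFieldType because that is where the library's
   topology on the scalars lives; used below at R[i]. *)
Definition expmx (K : numFieldType) (n : nat) (A : 'M[K]_n) : 'M[K]_n :=
  limn (series (fun k => (k`!%:R)^-1 *: A ^+ k)).

Section HilbertSpace.
Context {R : realType}.
Implicit Types (n : nat).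

Definition vnorm n (v : 'cV[R[i]]_n) : R :=
  Num.sqrt (complex.Re ((v ^t* *m v) 0 0)).

Definition opnorm n (A : 'M[R[i]]_n) : R :=
  sup [set vnorm (A *m v) | v in [set v | vnorm v <= 1]].

Definition bracket n (u : 'cV[R[i]]_n) (A : 'M[R[i]]_n) (v : 'cV[R[i]]_n)
  : R[i] := (u ^t* *m A *m v) 0 0.

Definition is_eigenstate n (A : 'M[R[i]]_n) (v : 'cV[R[i]]_n) : Prop :=
  v != 0 /\ exists E : R[i], A *m v = E *: v.

Definition evolution n (H : 'M[R[i]]_n) (t : R) : 'M[R[i]]_n :=
  expmx ((0 -i* t) *: H).

End HilbertSpace.

(* (C^d)^{(x) T}, for a finite set T of sites, has the product basis indexed by
   configurations T -> 'I_d; its operators are matrices over an enumeration of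
   that basis. *)
Notation config d T := {ffun T -> 'I_d}.
Notation hdim d T := #|{: config d T}|.

Section ManyBody.
Context {R : realType} {d : nat} {T : finType}.

Definition op_of (K : config d T -> config d T -> R[i]) : 'M[R[i]]_(hdim d T) :=
  \matrix_(i, j) K (enum_val i) (enum_val j).

Definition entry (A : 'M[R[i]]_(hdim d T)) (s s' : config d T) : R[i] :=
  A (enum_rank s) (enum_rank s').

Definition product_state (psi : 'cV[R[i]]_d) : 'cV[R[i]]_(hdim d T) :=
  \col_i \prod_(y : T) psi ((enum_val i : config d T) y) 0.

(* rho (x) 1 *)
Definition site_op (x : T) (rho : 'M[R[i]]_d) : 'M[R[i]]_(hdim d T) :=
  op_of (fun s s' =>
    if [forall y, (y != x) ==> (s y == s' y)] then rho (s x) (s' x) else 0).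

Definition update (x : T) (c : 'I_d) (s : config d T) : config d T :=
  [ffun y => if y == x then c else s y].

(* Partial trace over all sites but x. The configurations s with s x = a
   enumerate the basis of the environment. *)
Definition ptrace (x : T) (M : 'M[R[i]]_(hdim d T)) : 'M[R[i]]_d :=
  \matrix_(a, c) \sum_(s : config d T | s x == a) entry M s (update x c s).

(* The operator A on the sites 'I_m, placed on the sites f 0, ..., f (m - 1)
   and tensored with the identity elsewhere; meaningful for injective f. *)
Definition embed (m : nat) (f : 'I_m -> T) (A : 'M[R[i]]_(hdim d 'I_m))
  : 'M[R[i]]_(hdim d T) :=
  op_of (fun s s' =>
    if [forall y, (y \notin codom f) ==> (s y == s' y)]
    then A (enum_rank [ffun i => s (f i)]) (enum_rank [ffun i => s' (f i)])
    else 0).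

Definition reduced_density (H : 'M[R[i]]_(hdim d T)) (Psi : 'cV[R[i]]_(hdim d T))
    (x : T) (t : R) : 'M[R[i]]_d :=
  ptrace x (evolution H t *m Psi *m Psi ^t* *m (evolution H t) ^t*).

(* Extended-real valued, as the overlap may vanish: then the value is +oo. *)
Definition local_rate (H : 'M[R[i]]_(hdim d T)) (Psi : 'cV[R[i]]_(hdim d T))
    (x : T) (t : R) : \bar R :=
  (- lne (complex.Re
      (bracket Psi (site_op x (reduced_density H Psi x t)) Psi))%:E)%E.

Definition fidelity (H : 'M[R[i]]_(hdim d T)) (Psi : 'cV[R[i]]_(hdim d T))
    (t : R) : R :=
  Normc.normc (bracket Psi (evolution H t) Psi).

End ManyBody.

Definition hamiltonian (R : realType) (d D L m : nat) (s : 'I_m -> lattice D)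
    (h0 : 'M[R[i]]_(hdim d 'I_m)) : 'M[R[i]]_(hdim d (torus D L)) :=
  \sum_(x : torus D L) embed (fun i => shift x (s i)) h0.

(* Main.v *)
Require Import Defs.
From HB Require Import structures.
From mathcomp Require Import all_boot all_order all_algebra.
From mathcomp Require Import all_classical all_reals all_analysis.
From mathcomp Require Import complex spectral.
From mathcomp Require Import ring lra zify.

Set Implicit Arguments.
Unset Strict Implicit.
Unset Printing Implicit Defensive.

Import Order.TTheory GRing.Theory Num.Theory.
Import numFieldNormedType.Exports.

Local Open Scope ring_scope.

(* The fidelity is at most the expectation, in the evolved state, of a product of
   one-site projections onto psi, taken at the centres of disjoint boxes. In the
   Heisenberg picture a Lieb-Robinson bound replaces each factor by an observable
   of its own box, up to an error exponentially small in the side of the box; the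
   product state then factorizes, which bounds F^2 by exp(-nk) plus n times the
   error, where n is the number of boxes. Boxes of side about r/2 with
   r = (L^D k)^(1/(1+D)) give n k >= r and an error much smaller than exp(-r/4).
   For small times, k = 0 would force the state to return to itself up to a phase;
   such times form a discrete subgroup of the reals unless the state is an
   eigenstate, so the countably many values of L exclude only countably many
   times. *)

(** * Inner product and norm of complex vectors *)

Section Vectors.
Local Open Scope complex_scope. Local Open Scope ring_scope.
Local Open Scope sesquilinear_scope.
Context {R : realType}.
Implicit Types (n : nat).
Local Notation C := R[i].
Local Notation normc := Normc.normc.

(** The constant must not depend on L, whereas the rate k does and might tend to 0 as L grows.
    Replacing the factors in n boxes costs n times the localization error, and n <= L^D = r^(D+1)/k
    is controlled by a power of r only if k is bounded below. This is why the overlap is compared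
    with that of an isolated box, which does not involve L: the comparison yields either such a
    lower bound or the boundedness of L^D k. Since tau is fixed, the spatial decay rate in the
    Lieb-Robinson bound can be made as large as desired at the price of a larger prefactor. It is
    chosen so that the error is exp(-2r) up to powers of r, and one factor exp(-r) absorbs these
    powers. Taking half of r as the side of a box compensates for rounding in the number of
    boxes. *)

Lemma normcC (z : C) : (normc z)%:C = `|z|.
Proof. by []. Qed.

Lemma normc_ge0 (z : C) : 0 <= normc z.
Proof. by rewrite -ler0c normcC. Qed.

Lemma rcM (x y : R) : (x * y)%:C = x%:C * y%:C.
Proof. exact: rmorphM. Qed.

Lemma rcD (x y : R) : (x + y)%:C = x%:C + y%:C.
Proof. exact: rmorphD. Qed.

Lemma rcX (x : R) k : (x ^+ k)%:C = x%:C ^+ k.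
Proof. exact: rmorphXn. Qed.

Lemma normc_leD (x y : C) :
  normc (x + y) <= normc x + normc y.
Proof. by rewrite -lecR rcD !normcC ler_normD. Qed.

Definition dot n (u v : 'cV[C]_n) : C := (u ^t* *m v) 0 0.

Lemma dotE n (u v : 'cV[C]_n) : dot u v = \sum_i (u i 0)^* * v i 0.
Proof. by rewrite /dot mxE; apply: eq_bigr => i _; rewrite !mxE. Qed.

Lemma dot_dotmx n (u v : 'cV[C]_n) : dot u v = dotmx v^T u^T.
Proof.
rewrite dotE dotmxE mxE; apply: eq_bigr => i _.
by rewrite !mxE mulrC.
Qed.

Lemma dot_adj n m (A : 'M[C]_(n, m)) u v : dot u (A *m v) = dot (A ^t* *m u) v.
Proof. by rewrite /dot trmx_mul map_mxM /= trmxCK mulmxA. Qed.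

Lemma dotDr n (u v w : 'cV[C]_n) : dot u (v + w) = dot u v + dot u w.
Proof. by rewrite /dot mulmxDr mxE. Qed.

Lemma dotDl n (u v w : 'cV[C]_n) : dot (v + w) u = dot v u + dot w u.
Proof. by rewrite /dot linearD /= map_mxD mulmxDl mxE. Qed.

Lemma dotBr n (u v w : 'cV[C]_n) : dot u (v - w) = dot u v - dot u w.
Proof. by rewrite /dot mulmxBr !mxE. Qed.

Lemma dotBl n (u v w : 'cV[C]_n) : dot (v - w) u = dot v u - dot w u.
Proof. by rewrite /dot linearB /= map_mxB mulmxBl !mxE. Qed.

Lemma dotZr n (u v : 'cV[C]_n) a : dot u (a *: v) = a * dot u v.
Proof. by rewrite /dot -scalemxAr mxE. Qed.

Lemma dotZl n (u v : 'cV[C]_n) a : dot (a *: u) v = a^* * dot u v.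
Proof. by rewrite /dot linearZ /= map_mxZ -scalemxAl mxE. Qed.

Lemma dot_conj n (u v : 'cV[C]_n) : (dot u v)^* = dot v u.
Proof.
rewrite !dotE rmorph_sum; apply: eq_bigr => i _.
by rewrite rmorphM /= conjCK mulrC.
Qed.

Lemma dot0l n (v : 'cV[C]_n) : dot 0 v = 0.
Proof. by rewrite /dot linear0 map_mx0 mul0mx mxE. Qed.

Lemma dotvv_ge0 n (v : 'cV[C]_n) : 0 <= dot v v.
Proof. by rewrite dotE sumr_ge0 // => i _; rewrite mulrC mul_conjC_ge0. Qed.

Lemma vnormE n (v : 'cV[C]_n) : ((vnorm v) ^+ 2)%:C = dot v v.
Proof.
rewrite /vnorm -/(dot v v); have := dotvv_ge0 v.
case: (dot v v) => a b; rewrite lecE /= => /andP[/eqP -> a0].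
by rewrite sqr_sqrtr.
Qed.

Lemma vnorm_ge0 n (v : 'cV[C]_n) : 0 <= vnorm v.
Proof. exact: sqrtr_ge0. Qed.

Lemma vnorm_sum n (v : 'cV[C]_n) : vnorm v ^+ 2 = \sum_i normc (v i 0) ^+ 2.
Proof.
apply: complexI; rewrite vnormE dotE rmorph_sum /=; apply: eq_bigr => i _.
by rewrite rcX normcC normCK mulrC.
Qed.

Lemma vnorm_eq0 n (v : 'cV[C]_n) : vnorm v = 0 -> v = 0.
Proof.
move=> v0; apply/eqP; have := vnormE v.
rewrite v0 expr0n /= dot_dotmx => /esym/eqP.
by rewrite dnorm_eq0 => /eqP h; rewrite -(trmxK v) h trmx0.
Qed.

Lemma vnorm0 n : vnorm (0 : 'cV[C]_n) = 0.
Proof.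
by apply/eqP; rewrite -sqrf_eq0; apply/eqP/complexI; rewrite vnormE dot0l.
Qed.

Lemma vnormZ n (v : 'cV[C]_n) a : vnorm (a *: v) = normc a * vnorm v.
Proof.
apply/eqP; rewrite -(@eqrXn2 _ 2) ?mulr_ge0 ?vnorm_ge0 ?normc_ge0//.
apply/eqP/complexI; rewrite vnormE dotZr dotZl exprMn rcM vnormE.
by rewrite rcX normcC normCK mulrA.
Qed.

Lemma cauchy_schwarz n (u v : 'cV[C]_n) : normc (dot u v) <= vnorm u * vnorm v.
Proof.
rewrite -(@ler_pXn2r _ 2) ?nnegrE ?mulr_ge0 ?vnorm_ge0 ?normc_ge0//.
rewrite -lecR rcX normcC exprMn rcM !vnormE !dot_dotmx mulrC.
by have [] := CauchySchwarz (@dotmx C n) v^T u^T.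
Qed.

Lemma vnormD n (u v : 'cV[C]_n) : vnorm (u + v) <= vnorm u + vnorm v.
Proof.
rewrite -(@ler_pXn2r _ 2) ?nnegrE ?addr_ge0 ?vnorm_ge0//.
rewrite -lecR vnormE sqrrD !rcD /= !vnormE !dotDr !dotDl -addrA.
rewrite -[leRHS]addrA lerD2l addrA lerD2r addrC.
rewrite -(dot_conj u v) addcJ mulr_natl mulr2n.
rewrite -!rcD lecR; have := cauchy_schwarz u v.
have : complex.Re (dot u v) <= normc (dot u v).
  by rewrite -lecR; apply: le_trans (normc_ge_Re _); rewrite lecR ler_norm.
by move=> h1 h2; apply: lerD; exact: le_trans h1 h2.
Qed.

Lemma vnormN n (v : 'cV[C]_n) : vnorm (- v) = vnorm v.
Proof. rewrite -scaleN1r vnormZ; have -> : normc (-1 : C) = 1; last by rewrite mul1r.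
by apply: complexI; rewrite normcC normrN1. Qed.

Lemma vnorm_unitary n (U : 'M[C]_n) (v : 'cV[C]_n) : U ^t* *m U = 1%:M ->
  vnorm (U *m v) = vnorm v.
Proof.
move=> UU; apply/eqP; rewrite -(@eqrXn2 _ 2) ?vnorm_ge0//; apply/eqP/complexI.
by rewrite !vnormE dot_adj mulmxA UU mul1mx.
Qed.

Lemma proj_dot n (P : 'M[C]_n) v : P^t* = P -> P *m P = P ->
  dot v (P *m v) = ((vnorm (P *m v)) ^+ 2)%:C.
Proof.
move=> Pa PP; rewrite vnormE.
have -> : dot (P *m v) (P *m v) = dot (P^t* *m v) (P *m v) by rewrite Pa.
by rewrite -dot_adj mulmxA PP.
Qed.

End Vectors.

(** * Upper bounds on operator norms *)

Section OperatorBounds.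
Local Open Scope complex_scope. Local Open Scope ring_scope.
Local Open Scope sesquilinear_scope.
Context {R : realType}.
Implicit Types (n : nat) (c : R).
Local Notation C := R[i].
Local Notation normc := Normc.normc.

(** A bound on the operator norm as a predicate rather than through the supremum [opnorm]: such
    bounds compose directly under sums, products and conjugation. *)
Record opb n (A : 'M[C]_n) c : Prop := Opb {
  opb_ge0 : 0 <= c;
  opb_bound : forall v : 'cV[C]_n, vnorm (A *m v) <= c * vnorm v }.

Lemma opb_le n (A : 'M[C]_n) c c' : opb A c -> c <= c' -> opb A c'.
Proof.
move=> [c0 Ac] cc'; split=> [|v]; first exact: le_trans cc'.
by apply: le_trans (Ac v) _; rewrite ler_wpM2r ?vnorm_ge0.
Qed.

Lemma opb0 n c : 0 <= c -> opb (0 : 'M[C]_n) c.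
Proof. by move=> c0; split=> [//|v]; rewrite mul0mx vnorm0 mulr_ge0 ?vnorm_ge0. Qed.

Lemma opb1 n : opb (1%:M : 'M[C]_n) 1.
Proof. by split=> [|v]; rewrite ?ler01 // mul1mx mul1r. Qed.

Lemma opbM n (A B : 'M[C]_n) a b : opb A a -> opb B b -> opb (A *m B) (a * b).
Proof.
move=> [a0 Aa] [b0 Bb]; split=> [|v]; first exact: mulr_ge0.
rewrite -mulmxA; apply: le_trans (Aa _) _.
by rewrite -mulrA ler_wpM2l.
Qed.

Lemma opbD n (A B : 'M[C]_n) a b : opb A a -> opb B b -> opb (A + B) (a + b).
Proof.
move=> [a0 Aa] [b0 Bb]; split=> [|v]; first exact: addr_ge0.
by rewrite mulmxDl; apply: le_trans (vnormD _ _) _; rewrite mulrDl lerD.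
Qed.

Lemma opbN n (A : 'M[C]_n) a : opb A a -> opb (- A) a.
Proof. by move=> [a0 Aa]; split=> [|v]; rewrite ?mulNmx ?vnormN. Qed.

Lemma opbB n (A B : 'M[C]_n) a b : opb A a -> opb B b -> opb (A - B) (a + b).
Proof. by move=> Aa /opbN; apply: opbD. Qed.

Lemma opbZ n (A : 'M[C]_n) a z : opb A a -> opb (z *: A) (normc z * a).
Proof.
move=> [a0 Aa]; split=> [|v]; first by rewrite mulr_ge0 ?normc_ge0.
by rewrite -scalemxAl vnormZ -mulrA ler_wpM2l ?normc_ge0.
Qed.

Lemma opb_sum n (I : Type) (r : seq I) (P : pred I) (F : I -> 'M[C]_n)
    (f : I -> R) : (forall i, P i -> opb (F i) (f i)) ->
  opb (\sum_(i <- r | P i) F i) (\sum_(i <- r | P i) f i).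
Proof.
move=> h; apply: (big_ind2 (@opb n)) => //; first exact: opb0.
by move=> *; apply: opbD.
Qed.

Lemma opb_comm n (A B : 'M[C]_n) a b :
  opb A a -> opb B b -> opb (A *m B - B *m A) (2 * (a * b)).
Proof.
move=> Aa Bb; rewrite mulr_natl mulr2n; apply: opbB; first exact: opbM.
by rewrite mulrC; apply: opbM.
Qed.

Lemma opb_unitary n (U : 'M[C]_n) : U ^t* *m U = 1%:M -> opb U 1.
Proof.
move=> UU; split=> [|v]; rewrite ?mul1r ?ler01 // le_eqVlt; apply/orP; left.
rewrite -(@eqrXn2 _ 2) ?vnorm_ge0//; apply/eqP/complexI.
by rewrite !vnormE dot_adj mulmxA UU mul1mx.
Qed.

Lemma opb_delta n (i j : 'I_n) : opb (delta_mx i j : 'M[C]_n) 1.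
Proof.
split=> // v.
rewrite mul1r -(@ler_pXn2r _ 2) ?nnegrE ?vnorm_ge0// !vnorm_sum.
rewrite (bigD1 i) //= big1 ?addr0 => [|k ki].
  rewrite mxE (bigD1 j) //= big1 ?addr0 => [|l lj].
    rewrite mxE !eqxx mul1r (bigD1 j) //= lerDl sumr_ge0 // => k _.
    by rewrite exprn_ge0 ?normc_ge0.
  by rewrite mxE (negPf lj) andbF mul0r.
rewrite mxE big1 ?Normc.normc0 ?expr0n// => l _.
by rewrite mxE (negPf ki) mul0r.
Qed.

Lemma opb_exists n (A : 'M[C]_n) : exists2 c, 0 < c & opb A c.
Proof.
suff [c Ac] : exists c, opb A c.
  exists (c + 1); first by rewrite ltr_pwDr // (opb_ge0 Ac).
  by apply: opb_le Ac _; rewrite lerDl.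
rewrite [A]matrix_sum_delta.
exists (\sum_i \sum_j normc (A i j) * 1).
apply: opb_sum => i _; apply: opb_sum => j _; apply: opbZ; exact: opb_delta.
Qed.

(** Used to let the slack [eta] of [discrete_gronwall] tend to 0. *)
Lemma opb_closed n (A : 'M[C]_n) c :
  (forall e, 0 < e -> opb A (c + e)) -> opb A c.
Proof.
move=> h; split=> [|v].
  by apply/ler_addgt0Pl => e e0; rewrite addrC (opb_ge0 (h e e0)).
apply/ler_addgt0Pl => e e0.
have [v0 | v0] := eqVneq (vnorm v) 0.
  have -> : v = 0 by exact: vnorm_eq0.
  by rewrite mulmx0 vnorm0 mulr0 addr0 ltW.
have vp : 0 < vnorm v by rewrite lt_neqAle eq_sym v0 vnorm_ge0.
have [_ /(_ v)] := h (e / vnorm v) (divr_gt0 e0 vp).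
by rewrite mulrDl divfK // addrC.
Qed.

Lemma opb_eq0 n (A : 'M[C]_n) : opb A 0 -> A = 0.
Proof.
move=> [_ h]; apply/matrixP => i j.
have : A *m (delta_mx j 0 : 'cV[C]_n) = 0.
  apply: vnorm_eq0; apply/eqP; rewrite eq_le vnorm_ge0 andbT.
  by rewrite -(mul0r (vnorm (delta_mx j 0 : 'cV[C]_n))).
move/matrixP/(_ i 0); rewrite !mxE (bigD1 j) //= big1 => [|k kj].
  by rewrite mxE !eqxx mulr1 addr0.
by rewrite mxE (negPf kj) mulr0.
Qed.

Lemma opb_dot n (A : 'M[C]_n) c u v :
  opb A c -> normc (dot u (A *m v)) <= c * (vnorm u * vnorm v).
Proof.
move=> [c0 Ac]; apply: le_trans (cauchy_schwarz _ _) _.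
by rewrite mulrCA ler_wpM2l ?vnorm_ge0.
Qed.

(** By Cauchy-Schwarz |Pv|^2 = <v, Pv> <= |v| |Pv|; divide by |Pv|. *)
Lemma opb_proj_idem n (P : 'M[C]_n) : P^t* = P -> P *m P = P -> opb P 1.
Proof.
move=> Pa PP; split=> // v; rewrite mul1r.
have [->|nz] := eqVneq (vnorm (P *m v)) 0; first exact: vnorm_ge0.
have p0 : 0 < vnorm (P *m v) by rewrite lt_neqAle eq_sym nz vnorm_ge0.
rewrite -(ler_pM2l p0) -expr2 mulrC; apply: le_trans (cauchy_schwarz v (P *m v)).
rewrite (proj_dot _ Pa PP) /= expr0n addr0 sqrtr_sqr.
by rewrite ger0_norm ?sqr_ge0.
Qed.

End OperatorBounds.


(** * The propagator exp(-itH) and the Heisenberg picture *)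

Section Evolution.
Local Open Scope complex_scope. Local Open Scope ring_scope.
Local Open Scope classical_set_scope.
Local Open Scope sesquilinear_scope.
Context {R : realType}.
Implicit Types (n : nat) (c : R).
Local Notation C := R[i].
Local Notation normc := Normc.normc.

Lemma sin_norm_le (x : R) : `|sin x| <= `|x|.
Proof.
wlog x0 : x / 0 <= x.
  move=> h; have [/h//|/ltW x0] := leP 0 x.
  by rewrite -normrN -sinN -(normrN x); apply: h; rewrite oppr_ge0.
have [|c _] := @MVT_segment R sin cos 0 x x0.
  by apply: continuous_subspaceT => y; exact: continuous_sin.
rewrite sin0 !subr0 => ->; rewrite normrM ler_piMl //; exact: cos_max.
Qed.

Lemma cosB1_norm_le (x : R) : `|cos x - 1| <= x ^+ 2 /\ `|cos x - 1| <= `|x|.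
Proof.
wlog x0 : x / 0 <= x.
  move=> h; have [/h//|/ltW x0] := leP 0 x.
  by rewrite -cosN -(normrN x) -sqrrN; apply: h; rewrite oppr_ge0.
have [|c] := @MVT_segment R cos (fun x => - sin x) 0 x x0.
  by apply: continuous_subspaceT => y; exact: continuous_cos.
rewrite in_itv /= => /andP[c0 cx]; rewrite cos0 subr0 => ->; rewrite normrM normrN.
split; last by rewrite ler_piMl //; exact: sin_max.
rewrite (ger0_norm x0) expr2 ler_wpM2r //; apply: le_trans (sin_norm_le c) _.
by rewrite ger0_norm.
Qed.

Lemma sinBid_norm_le (x : R) : `|sin x - x| <= x ^+ 2.
Proof.
wlog x0 : x / 0 <= x.
  move=> h; have [/h//|/ltW x0] := leP 0 x.
  rewrite -sqrrN -normrN opprB addrC -sinN -[X in _ + X]opprK.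
  by apply: h; rewrite oppr_ge0.
have [|c] := @MVT_segment R sin cos 0 x x0.
  by apply: continuous_subspaceT => y; exact: continuous_sin.
rewrite in_itv /= => /andP[c0 cx]; rewrite sin0 !subr0 => ->.
rewrite -[X in _ - X]mul1r -mulrBl normrM (ger0_norm x0) expr2 ler_wpM2r //.
by have [_ h] := cosB1_norm_le c; apply: le_trans h _; rewrite ger0_norm.
Qed.

(** This is exp(-ix), with the sign of the propagator. *)
Definition cis (x : R) : C := cos x -i* sin x.

Lemma cisD x y : cis (x + y) = cis x * cis y.
Proof.
apply/eqP; rewrite eq_complex /= cosD sinD mulrNN eqxx /=; apply/eqP.
by rewrite mulrN mulNr -opprD addrC [X in X + _]mulrC [X in _ + X]mulrC addrC.
Qed.

Lemma cis0 : cis 0 = 1.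
Proof. by rewrite /cis cos0 sin0 oppr0. Qed.

Lemma cis_conj x : (cis x)^* = cis (- x).
Proof. by apply/eqP; rewrite eq_complex /= cosN sinN !eqxx. Qed.

Lemma normc_ReIm (z : C) : normc z <= `|complex.Re z| + `|complex.Im z|.
Proof.
case: z => a b /=; rewrite -(@ler_pXn2r _ 2) ?nnegrE ?addr_ge0 ?sqrtr_ge0//.
rewrite sqr_sqrtr ?addr_ge0 ?sqr_ge0// sqrrD !real_normK ?num_real//.
by rewrite lerD2r lerDl mulrn_wge0 // mulr_ge0 ?normr_ge0.
Qed.

(** The real and the imaginary part of the remainder contribute x^2 each. *)
Lemma cis_taylor (x : R) : normc (cis x - 1 + (0 +i* x)) <= 2 * x ^+ 2.
Proof.
apply: le_trans (normc_ReIm _) _; rewrite /= mulr_natl mulr2n.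
rewrite oppr0 !addr0; apply: lerD; first by have [] := cosB1_norm_le x.
by rewrite -normrN opprD opprK; exact: sinBid_norm_le.
Qed.

Lemma cvg_complex (u : nat -> (C : numFieldType)) (l : (C : numFieldType)) :
  (fun k => complex.Re (u k) : R) @ \oo --> (complex.Re l : R) ->
  (fun k => complex.Im (u k) : R) @ \oo --> (complex.Im l : R) ->
  u @ \oo --> l.
Proof.
move=> /cvgrPdist_lt hr /cvgrPdist_lt hi; apply/cvgrPdist_lt => e.
case: e => a b; rewrite ltcE /= => /andP[/eqP -> a0].
have a2 : 0 < a / 2 by rewrite divr_gt0.
near=> k; rewrite -normcC ltcR.
apply: le_lt_trans (normc_ReIm _) _; rewrite (splitr a).
have -> : complex.Re (l - u k) = complex.Re l - complex.Re (u k) by case: (l) (u k) => ? ? [].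
have -> : complex.Im (l - u k) = complex.Im l - complex.Im (u k) by case: (l) (u k) => ? ? [].
apply: ltrD; first by near: k; exact: hr.
by near: k; exact: hi.
Unshelve. all: by end_near. Qed.

(** Shaped after [cos_coeff] and [sin_coeff]; the truncated predecessor at k = 0 is harmless because
    its factor vanishes there. *)
Lemma expr_negi k :
  (0 -i* 1) ^+ k = ((~~ odd k)%:R * (-1) ^+ k./2)
                -i* ((odd k)%:R * (-1) ^+ k.-1./2) :> C.
Proof.
elim: k => [|k IH]; first by rewrite !expr0 mulr1 mul0r oppr0.
rewrite exprS IH; apply/eqP; rewrite eq_complex /= !mul0r sub0r add0r negbK.
rewrite !mulN1r opprK eqxx andbT.
case: k {IH} => [|k] /=; first by rewrite !mul0r oppr0.
by rewrite exprS mulN1r mulrN.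
Qed.

Lemma cis_coeff (x : R) k :
  (k`!%:R)^-1 * (0 -i* x) ^+ k = cos_coeff x k -i* sin_coeff x k :> C.
Proof.
have -> : (0 -i* x) = x%:C * (0 -i* 1) :> C.
  by apply/eqP; rewrite eq_complex /= !mulr0 !mul0r subr0 mulrN mulr1 addr0 !eqxx.
have -> : (k`!%:R : C)^-1 = ((k`!%:R)^-1 : R)%:C.
  by rewrite fmorphV rmorph_nat.
rewrite exprMn -rcX expr_negi mulrA -rcM sin_coeffE cos_coeffE.
apply/eqP; rewrite eq_complex /= !mul0r subr0 addr0 mulrN.
by apply/andP; split; apply/eqP; ring.
Qed.

Lemma cvg_cis (x : R) :
  series (fun k => (k`!%:R)^-1 * (0 -i* x) ^+ k) @ \oo --> (cis x : (C : numFieldType)).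
Proof.
apply: cvg_complex => /=.
  rewrite (_ : (fun _ => _) = series (cos_coeff x)); last first.
    apply/funext => n; rewrite /series /=.
    elim/big_ind2 : _ => //.
      by move=> ? [? ?] ? [? ?] <- <-.
    by move=> i _; rewrite cis_coeff.
  by rewrite unlock; apply: is_cvg_series_cos_coeff.
rewrite (_ : (fun _ => _) = (fun n => - series (sin_coeff x) n)); last first.
  apply/funext => n; rewrite /series /= -sumrN.
  elim/big_ind2 : _ => //.
    by move=> ? [? ?] ? [? ?] <- <-.
  by move=> i _; rewrite cis_coeff.
apply: cvgN; rewrite unlock; apply: is_cvg_series_sin_coeff.
Qed.


Lemma cvg_finsum (K : numFieldType) (V : normedModType K) (I : Type) (r : seq I)
    (f : nat -> I -> V) (l : I -> V) :
  (forall j, (fun k => f k j) @ \oo --> l j) ->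
  (fun k => \sum_(j <- r) f k j) @ \oo --> \sum_(j <- r) l j.
Proof.
move=> h; elim: r => [|j r IH].
  by rewrite big_nil; under eq_cvg do rewrite big_nil; exact: cvg_cst.
rewrite big_cons; under eq_cvg do rewrite big_cons.
by apply: cvgD.
Qed.

Section SpectralFunction.
Context {n : nat} (P : 'M[C]_n) (PP : P ^t* *m P = 1%:M) (PP' : P *m P ^t* = 1%:M).
Implicit Types f g : 'I_n -> C.

(** Functional calculus in the eigenbasis given by [P]. Indexing [f] by eigenvectors rather than
    eigenvalues makes all operations pointwise. *)
Definition spectral_fun f : 'M[C]_n := P ^t* *m diag_mx (\row_j f j) *m P.

Lemma eq_spectral_fun f g : f =1 g -> spectral_fun f = spectral_fun g.
Proof. by move=> fg; congr spectral_fun; apply/funext. Qed.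

Lemma spectral_fun_sum f :
  spectral_fun f = \sum_j f j *: (P ^t* *m delta_mx j j *m P).
Proof.
rewrite /spectral_fun diag_mx_sum_delta mulmx_sumr mulmx_suml.
by apply: eq_bigr => j _; rewrite mxE -scalemxAr -scalemxAl.
Qed.

Lemma spectral_funD f g :
  spectral_fun f + spectral_fun g = spectral_fun (fun j => f j + g j).
Proof.
rewrite !spectral_fun_sum -big_split; apply: eq_bigr => j _ /=.
by rewrite scalerDl.
Qed.

Lemma spectral_funZ a f :
  a *: spectral_fun f = spectral_fun (fun j => a * f j).
Proof.
rewrite !spectral_fun_sum scaler_sumr; apply: eq_bigr => j _ /=.
by rewrite scalerA.
Qed.

Lemma spectral_funM f g :
  spectral_fun f *m spectral_fun g = spectral_fun (fun j => f j * g j).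
Proof.
rewrite /spectral_fun -!mulmxA (mulmxA P) PP' mul1mx (mulmxA (diag_mx _)).
rewrite mulmx_diag; congr (_ *m (diag_mx _ *m _)).
by apply/matrixP => i j; rewrite !mxE.
Qed.

Lemma spectral_fun1 : spectral_fun (fun=> 1) = 1%:M.
Proof.
rewrite /spectral_fun (_ : diag_mx _ = 1%:M); first by rewrite mulmx1.
by apply/matrixP => i j; rewrite !mxE.
Qed.

Lemma spectral_funX f k : spectral_fun f ^+ k = spectral_fun (fun j => f j ^+ k).
Proof.
elim: k => [|k IH]; first by rewrite expr0; exact/esym/spectral_fun1.
rewrite exprS IH -mulmxE spectral_funM.
by apply: eq_spectral_fun => j; rewrite exprS.
Qed.

Lemma spectral_fun_adj f :
  (spectral_fun f)^t* = spectral_fun (fun j => (f j)^*).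
Proof.
rewrite /spectral_fun trmx_mul map_mxM trmx_mul map_mxM trmxCK mulmxA.
congr (_ *m _ *m _).
apply/matrixP => i j; rewrite !mxE eq_sym; case: eqP => [->|_].
  by rewrite !mulr1n.
by rewrite !mulr0n rmorph0.
Qed.

(** The sum of the moduli is a crude bound, but it only enters the constant of a Taylor remainder,
    which disappears as the time step tends to 0. *)
Lemma opb_spectral_fun f : opb (spectral_fun f) (\sum_j normc (f j)).
Proof.
rewrite spectral_fun_sum; apply: opb_sum => j _; rewrite -[normc _]mulr1.
apply: opbZ; have Pu : opb P 1 by exact: opb_unitary.
have Pv : opb (P ^t*) 1 by apply: opb_unitary; rewrite trmxCK.
have := opbM (opbM Pv (opb_delta j j)) Pu.
by rewrite !mulr1.
Qed.

Lemma spectral_fun_cvg (u : nat -> 'I_n -> C) (l : 'I_n -> C) :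
  (forall j, (fun k => u k j) @ \oo --> (l j : (C : numFieldType))) ->
  (fun k => spectral_fun (u k)) @ \oo --> (spectral_fun l : 'M[(C : numFieldType)]_n).
Proof.
move=> h; rewrite spectral_fun_sum.
rewrite (_ : (fun k => _) = (fun k => \sum_j (u k j) *: (P ^t* *m delta_mx j j *m P))).
  apply: (@cvg_finsum _ 'M[(C : numFieldType)]_n) => j.
  by apply: cvgZr_tmp; exact: h.
by apply/funext => k; rewrite spectral_fun_sum.
Qed.

Lemma spectral_fun_exp (t : R) (lam : 'I_n -> R) :
  evolution (spectral_fun (fun j => (lam j)%:C)) t = spectral_fun (fun j => cis (t * lam j)).
Proof.
rewrite /evolution /expmx; apply: (@cvg_lim 'M[(C : numFieldType)]_n).
  exact: norm_hausdorff.
rewrite (_ : series _ = (fun N : nat => spectral_fun (fun j => series (fun k => (k`!%:R)^-1 *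
      (0 -i* (t * lam j)) ^+ k) N))).
  by apply: spectral_fun_cvg => j; exact: cvg_cis.
apply/funext => N; rewrite /series /= [RHS]spectral_fun_sum.
under [RHS]eq_bigr do rewrite scaler_suml.
rewrite exchange_big; apply: eq_bigr => k _ /=.
rewrite spectral_funZ spectral_funX spectral_fun_sum scaler_sumr.
apply: eq_bigr => j _; rewrite scalerA.
suff -> : (0 -i* t) * (lam j)%:C = 0 -i* (t * lam j) by exact: erefl.
apply/eqP; rewrite eq_complex /=.
by rewrite !mul0r !mulr0 subr0 add0r mulNr !eqxx.
Qed.

End SpectralFunction.

Lemma hermE n (H : 'M[C]_n) : H \is hermsymmx -> H ^t* = H.
Proof. by move/is_hermitianmxP; rewrite expr0 scale1r => <-. Qed.

Lemma spectral_theorem n (H : 'M[C]_n) : H \is hermsymmx ->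
  exists P : 'M[C]_n, exists lam : 'I_n -> R,
    [/\ P ^t* *m P = 1%:M, P *m P ^t* = 1%:M &
        H = spectral_fun P (fun j => (lam j)%:C)].
Proof.
move=> Hh; have Pu := spectral_unitarymx H.
exists (spectralmx H), (fun j => complex.Re (spectral_diag H 0 j)); split.
- by rewrite -(invmx_unitary Pu) mulVmx ?spectral_unit.
- exact/unitarymxP.
have /hermitian_normalmx/orthomx_spectralP := Hh.
rewrite /spectral_fun; cbv beta.
have <- : spectral_diag H = \row_j (complex.Re (spectral_diag H 0 j))%:C.
  apply/rowP => j; rewrite mxE RRe_real; first exact: erefl.
  by move/mxOverP: (hermitian_spectral_diag_real Hh); apply.
by rewrite (invmx_unitary Pu).
Qed.

(* The quadratic Taylor bound stands in for differentiability: differential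
   inequalities for the dynamics are run through finite time steps. *)
Record is_evol n (H : 'M[C]_n) (V : R -> 'M[C]_n) : Prop := IsEvol {
  evol0 : V 0 = 1%:M;
  evolD : forall s t, V (s + t) = V s *m V t;
  evol_adj : forall t, (V t)^t* = V (- t);
  evol_taylor : exists2 K, 0 <= K &
    forall t, opb (V t - 1%:M + (0 +i* t) *: H) (K * t ^+ 2) }.

Lemma evolution_is_evol n (H : 'M[C]_n) :
  H \is hermsymmx -> is_evol H (evolution H).
Proof.
move=> /spectral_theorem[P [lam [PP PP' ->]]].
have e t := spectral_fun_exp PP PP' t lam.
split.
- rewrite e -(spectral_fun1 PP); apply: eq_spectral_fun => j.
  by rewrite mul0r cis0.
- move=> s t; rewrite !e (spectral_funM PP'); apply: eq_spectral_fun => j.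
  by rewrite mulrDl cisD.
- move=> t; rewrite !e spectral_fun_adj; apply: eq_spectral_fun => j.
  by rewrite cis_conj mulNr.
exists (\sum_j 2 * (lam j) ^+ 2).
  by apply: sumr_ge0 => j _; rewrite mulr_ge0 ?sqr_ge0.
move=> t; have {e}-> : evolution (spectral_fun P (fun j => (lam j)%:C)) t - 1%:M
    + (0 +i* t) *: spectral_fun P (fun j => (lam j)%:C) =
    spectral_fun P (fun j => cis (t * lam j) - 1 + (0 +i* (t * lam j))).
  rewrite {}e -(spectral_fun1 PP) -(scaleN1r (spectral_fun _ _)).
  rewrite !spectral_funZ !spectral_funD; apply: eq_spectral_fun => j.
  rewrite mulN1r; congr (_ + _).
  apply/eqP; rewrite eq_complex /=.
  by rewrite !mul0r !mulr0 subr0 add0r !eqxx.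
apply: (opb_le (opb_spectral_fun PP PP' _)).
rewrite mulr_suml; apply: ler_sum => j _; apply: le_trans (cis_taylor _) _.
by rewrite exprMn mulrA mulrAC.
Qed.

Lemma evol_unitary n (H : 'M[C]_n) V t : is_evol H V -> (V t)^t* *m V t = 1%:M.
Proof. by move=> [V0 VD Va _]; rewrite Va -VD addNr. Qed.


Lemma evol_opb n (H : 'M[C]_n) V t : is_evol H V -> opb (V t) 1.
Proof. by move=> h; apply: opb_unitary; exact: (evol_unitary t h). Qed.

Lemma evol_inv n (H : 'M[C]_n) V t : is_evol H V -> V (- t) *m V t = 1%:M.
Proof. by move=> [V0 VD _ _]; rewrite -VD addNr. Qed.

Definition heis n (V : R -> 'M[C]_n) (A : 'M[C]_n) t := V (- t) *m A *m V t.

Lemma heisD n (H : 'M[C]_n) V A s t : is_evol H V ->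
  heis V A (s + t) = heis V (heis V A s) t.
Proof.
move=> h; rewrite /heis opprD [- s - t]addrC !(evolD h) !mulmxA.
exact: erefl.
Qed.

Lemma heis0 n (H : 'M[C]_n) V A : is_evol H V -> heis V A 0 = A.
Proof. by move=> h; rewrite /heis oppr0 !(evol0 h) mul1mx mulmx1. Qed.

Lemma opb_heis n (H : 'M[C]_n) V A t c : is_evol H V -> opb A c -> opb (heis V A t) c.
Proof.
move=> h Ac; rewrite -[c]mul1r -[1 * c]mulr1.
exact: (opbM (opbM (evol_opb (- t) h) Ac) (evol_opb t h)).
Qed.

Lemma heisB n (V : R -> 'M[C]_n) (A B : 'M[C]_n) t :
  heis V (A - B) t = heis V A t - heis V B t.
Proof. by rewrite /heis mulmxBr mulmxBl. Qed.

Definition comm n (A B : 'M[C]_n) := A *m B - B *m A.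

(** With [G] standing for ieH and [X], [Y] for the Taylor remainders of the two propagators, every
    term on the right is of second order in e. *)
Lemma conj_taylor_identity n (X Y A G : 'M[C]_n) :
  (X + (1%:M + G)) *m A *m (Y + (1%:M - G)) - A - (G *m A - A *m G) =
  X *m A *m (Y + (1%:M - G)) + (1%:M + G) *m A *m Y - G *m A *m G.
Proof.
set V := Y + _.
have E1 : (X + (1%:M + G)) *m A *m V = X *m A *m V + (1%:M + G) *m A *m V.
  by rewrite (mulmxDl X) (mulmxDl (X *m A)).
have E2 : (1%:M + G) *m A *m V =
    (1%:M + G) *m A *m Y + (1%:M + G) *m A *m (1%:M - G).
  by rewrite -mulmxDr.
have E3 : (1%:M + G) *m A *m (1%:M - G) =
    A + (G *m A - A *m G) - G *m A *m G.
  by rewrite mulmxBr mulmx1 mulmxDl mul1mx mulmxDl opprD !addrA.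
rewrite E1 E2 E3; move: (G *m A - A *m G) (G *m A *m G) => w q.
rewrite -!addrA; congr (_ + (_ + _)).
by rewrite (addrCA w) (addrCA A) -opprD (addrA A) subrr addr0.
Qed.

(** The derivative is i[H, A]. The constant [K] depends on H, hence on L, but as it multiplies e^2
    it does not survive the limit of small time steps, and uniformity in L is preserved. *)
Lemma heis_taylor n (H : 'M[C]_n) V : is_evol H V -> exists2 K, 0 <= K &
  forall (A : 'M[C]_n) c e, opb A c -> 0 <= e <= 1 ->
    opb (heis V A e - A - (0 +i* e) *: comm H A) (K * c * e ^+ 2).
Proof.
move=> h; have [K K0 hK] := evol_taylor h; have [b b0 Hb] := opb_exists H.
exists (K + (1 + b) * K + b * b); first by rewrite !addr_ge0 ?mulr_ge0 ?addr_ge0// ltW.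
move=> A c e Ac /andP[e0 e1].
set z : C := 0 +i* e.
have zz : normc z = e by rewrite /= expr0n add0r sqrtr_sqr ger0_norm.
have z2 : z * z = (- (e ^+ 2))%:C.
  by apply/eqP; rewrite eq_complex /= !mul0r mulr0 sub0r addr0 -expr2 !eqxx.
have c0 := opb_ge0 Ac.
pose X := V (- e) - 1%:M - z *: H; pose Y := V e - 1%:M + z *: H.
have XK : opb X (K * e ^+ 2).
  have := hK (- e); rewrite sqrrN; congr (opb _ _); rewrite /X; congr (_ + _).
  rewrite -scaleNr; congr (_ *: _).
  by apply/eqP; rewrite eq_complex /= oppr0 !eqxx.
have YK : opb Y (K * e ^+ 2) by exact: hK.
have Zb : opb (1%:M + z *: H) (1 + b).
  apply: opbD; first exact: opb1.
  apply: (opb_le (opbZ z Hb)); rewrite zz.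
  by rewrite ler_piMl // ltW.
have -> : heis V A e - A - z *: comm H A =
   X *m A *m V e + (1%:M + z *: H) *m A *m Y + (- (z * z)) *: (H *m A *m H).
  rewrite /heis (_ : V (- e) = X + (1%:M + z *: H)); last by rewrite /X addrA addrAC !subrK.
  rewrite (_ : V e = Y + (1%:M - z *: H)); last by rewrite /Y addrA addrAC addrK subrK.
  have -> : z *: comm H A = (z *: H) *m A - A *m (z *: H).
    by rewrite /comm scalerBr -scalemxAl -scalemxAr.
  rewrite conj_taylor_identity scaleNr -scalerA.
  by rewrite -!scalemxAl -scalemxAr.
have -> : (K + (1 + b) * K + b * b) * c * e ^+ 2 =
  K * e ^+ 2 * c * 1 + (1 + b) * c * (K * e ^+ 2) + e ^+ 2 * (b * c * b) by ring.
apply: opbD; first apply: opbD.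
- exact: (opbM (opbM XK Ac) (evol_opb e h)).
- exact: (opbM (opbM Zb Ac) YK).
have := opbZ (- (z * z)) (opbM (opbM Hb Ac) Hb).
congr (opb _ (_ * _)).
by rewrite z2 -rmorphN opprK /= expr0n addr0 sqrtr_sqr ger0_norm ?sqr_ge0.
Qed.

End Evolution.

(** * Gronwall's inequality, Duhamel's formula and the Lieb-Robinson bound *)

Section Locality.
Local Open Scope complex_scope. Local Open Scope ring_scope.
Local Open Scope sesquilinear_scope.
Context {R : realType}.
Implicit Types (n : nat) (c : R).
Local Notation C := R[i].
Local Notation normc := Normc.normc.

(** [Inv t w] reads: w bounds some quantity at time t. Over N steps of length t/N the gains multiply
    to at most exp(a t), while the quadratic errors add up to K t^2/N before amplification, which is
    at most [eta] for large N. *)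
Lemma discrete_gronwall (Inv : R -> R -> Prop) (a K tau w0 : R) :
  0 <= a -> 0 <= K -> 0 <= w0 ->
  (forall t w w', Inv t w -> w <= w' -> Inv t w') ->
  (forall t e w, 0 <= t -> 0 <= e <= 1 -> t + e <= tau -> 0 <= w -> Inv t w ->
     Inv (t + e) (w * (1 + a * e) + K * e ^+ 2)) ->
  Inv 0 w0 ->
  forall t eta, 0 <= t <= tau -> 0 < eta -> Inv t (expR (a * t) * (w0 + eta)).
Proof.
move=> a0 K0 w00 mono step I0 t eta /andP[t0 tt] eta0.
pose X := t + K * t ^+ 2 / eta.
have X0 : 0 <= X by rewrite addr_ge0 ?divr_ge0 ?mulr_ge0 ?sqr_ge0// ltW.
pose N := (Num.truncn X).+1.
have NX : X <= N%:R by apply/ltW/truncnS_gt.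
have N0 : (0 : R) < N%:R by rewrite ltr0n.
pose e := t / N%:R.
have e0 : 0 <= e by rewrite divr_ge0 // ltW.
have e1 : e <= 1.
  rewrite ler_pdivrMr// mul1r; apply: le_trans NX; rewrite lerDl.
  by rewrite divr_ge0 ?mulr_ge0 ?sqr_ge0// ltW.
have Ne : N%:R * e = t by rewrite mulrC divfK // gt_eqF.
have H j : (j <= N)%N ->
    Inv (j%:R * e) (expR (a * (j%:R * e)) * (w0 + j%:R * (K * e ^+ 2))).
  elim: j => [_|j IH jN]; first by rewrite !mul0r mulr0 expR0 mul1r addr0.
  have je0 : 0 <= j%:R * e by rewrite mulr_ge0.
  have Ke0 : 0 <= K * e ^+ 2 by rewrite mulr_ge0 ?sqr_ge0.
  have w1 : 0 <= w0 + j%:R * (K * e ^+ 2) by rewrite addr_ge0// mulr_ge0.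
  have := step _ e _ je0 _ _ _ (IH (ltnW jN)).
  rewrite e0 e1 -natr1 (mulrDl _ _ e) mul1r => /(_ isT) h.
  apply: mono; first apply: h.
  - apply: le_trans tt; rewrite -Ne -[X in _ + X]mul1r -mulrDl natr1.
    by rewrite ler_wpM2r// ler_nat.
  - by rewrite mulr_ge0 ?expR_ge0.
  rewrite [leRHS](_ : _ = expR (a * (j%:R * e)) * (w0 + j%:R * (K * e ^+ 2)) * expR (a * e) +
      expR (a * (j%:R * e + e)) * (K * e ^+ 2)); last first.
    by rewrite !mulrDr expRD; ring.
  apply: lerD.
    by rewrite ler_wpM2l ?mulr_ge0 ?expR_ge0// expR_ge1Dx.
  by rewrite ler_peMl// -[leLHS]expR0 ler_expR mulr_ge0 ?addr_ge0.
have := H N (leqnn _); rewrite Ne => h; apply: mono h _.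
rewrite ler_wpM2l ?expR_ge0// lerD2l.
have -> : N%:R * (K * e ^+ 2) = K * t ^+ 2 / N%:R.
  by rewrite /e; field; rewrite gt_eqF.
rewrite ler_pdivrMr// (mulrC eta) -ler_pdivrMr//.
by apply: le_trans NX; rewrite lerDr.
Qed.

(** One time step changes the difference only to second order, so Gronwall applies with rate 0 and
    initial value 0; negative times follow by adjoints. This identifies a translated evolution with
    the original one. *)
Lemma evol_unique n (H : 'M[C]_n) V V' : is_evol H V -> is_evol H V' ->
  forall t, V t = V' t.
Proof.
move=> h h'.
suff pos t : 0 <= t -> V t = V' t.
  move=> t; have [/pos//|/ltW t0] := leP 0 t.
  rewrite -(opprK t) -(evol_adj h) -(evol_adj h') pos//.
  by rewrite oppr_ge0.
move=> t0; apply: subr0_eq; apply: opb_eq0; apply: opb_closed => eta eta0.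
rewrite add0r.
have [K K0 hK] := evol_taylor h; have [K' K'0 hK'] := evol_taylor h'.
have := @discrete_gronwall (fun t w => opb (V t - V' t) w) 0 (K + K') t 0 (lexx 0)
  (addr_ge0 K0 K'0) (lexx 0) (fun t w w' => @opb_le _ _ _ w w') _ _ t eta.
rewrite lexx t0 mul0r expR0 mul1r add0r; apply => //.
  move=> s e w s0 /andP[e0 e1] _ w0 Dw.
  rewrite (evolD h) (evolD h').
  have -> : V s *m V e - V' s *m V' e = (V s - V' s) *m V e + V' s *m (V e - V' e).
    by rewrite mulmxBl mulmxBr addrA subrK.
  have -> : V e - V' e = (V e - 1%:M + (0 +i* e) *: H) - (V' e - 1%:M + (0 +i* e) *: H).
    move: (V e) (V' e) (_ *: H) (1%:M) => x y z w'.
    by apply/matrixP => i j; rewrite !mxE; ring.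
  rewrite mul0r addr0 mulrDl; apply: opbD.
    exact: (opbM Dw (evol_opb e h)).
  rewrite -[X in opb _ X]mul1r; apply: (opbM (evol_opb s h')).
  exact: (opbB (hK e) (hK' e)).
by rewrite (evol0 h) (evol0 h') subrr; apply: opb0.
Qed.

Lemma commBl n (A B D : 'M[C]_n) : comm (A - B) D = comm A D - comm B D.
Proof. rewrite /comm mulmxBl mulmxBr; move: (A *m D) (B *m D) (D *m A) (D *m B) => x y z w.
by apply/matrixP => i j; rewrite !mxE; ring. Qed.

Lemma commDl n (A B D : 'M[C]_n) : comm (A + B) D = comm A D + comm B D.
Proof. by rewrite /comm mulmxDl mulmxDr opprD addrACA. Qed.

Lemma commZl n (A D : 'M[C]_n) z : comm (z *: A) D = z *: comm A D.
Proof. by rewrite /comm -scalemxAl -scalemxAr scalerBr. Qed.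

Lemma commBBZ n (X Y Z D : 'M[C]_n) z :
  comm (X - Y - z *: Z) D = comm X D - comm Y D - z *: comm Z D.
Proof. by rewrite !commBl commZl. Qed.

Lemma commC n (A D : 'M[C]_n) : comm A D = - comm D A.
Proof. by rewrite /comm opprB. Qed.

Lemma comm_suml n (I : Type) (r : seq I) (P : pred I) (F : I -> 'M[C]_n) D :
  comm (\sum_(i <- r | P i) F i) D = \sum_(i <- r | P i) comm (F i) D.
Proof. by rewrite /comm mulmx_suml mulmx_sumr sumrB. Qed.

(** The term [B, [G, h]] of Jacobi's identity drops out. *)
Lemma comm_jacobi n (G B h : 'M[C]_n) : comm G h = 0 ->
  comm (comm G B) h = comm G (comm B h).
Proof.
rewrite /comm => /subr0_eq Gh.
rewrite !(mulmxBl, mulmxBr) !mulmxA -Gh -(mulmxA B G h) Gh !mulmxA.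
move: (G *m B *m h) (B *m h *m G) (G *m h *m B) (h *m B *m G) => x y z w.
by apply/matrixP => i j; rewrite !mxE; ring.
Qed.

(* Duhamel's formula, in discretised form. *)
Lemma heis_perturbation n (H H' A : 'M[C]_n) V V' (gam tau : R) :
  is_evol H V -> is_evol H' V' -> opb A 1 -> 0 <= gam -> 0 <= tau ->
  (forall t, 0 <= t <= tau -> opb (comm (H - H') (heis V' A t)) gam) ->
  opb (heis V A tau - heis V' A tau) (gam * tau).
Proof.
move=> h h' A1 g0 t0 hg; apply: opb_closed => eta eta0.
have [K K0 hK] := heis_taylor h; have [K' K'0 hK'] := heis_taylor h'.
(* The source term is built into the invariant, since a Gronwall step admits only a multiplicative
   gain and a quadratic error. *)
pose Inv t w := opb (heis V A t - heis V' A t) (w + gam * t).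
have : Inv tau (expR (0 * tau) * (0 + eta)).
  2: by rewrite /Inv mul0r expR0 mul1r add0r (addrC eta).
apply: (@discrete_gronwall Inv 0 (K + K') tau 0) => //.
- by rewrite addr_ge0.
- by rewrite /Inv => t w w' Dw ww'; apply: opb_le Dw _; rewrite lerD2r.
- move=> t e w s0 /andP[e0 e1] te w0; rewrite /Inv => Dw.
  have te' : 0 <= t <= tau by rewrite s0 (le_trans _ te)// lerDl.
  rewrite (heisD _ _ _ h) (heisD _ _ _ h').
  set B' := heis V A t; set B := heis V' A t.
  have B1 : opb B 1 by exact: (opb_heis _ h' A1).
  (* Conjugation does not increase the old difference; the step adds two Taylor remainders and the
     commutator with [H - H']. *)
  have -> : heis V B' e - heis V' B e = heis V (B' - B) e +
     ((heis V B e - B - (0 +i* e) *: comm H B) -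
      (heis V' B e - B - (0 +i* e) *: comm H' B) + (0 +i* e) *: comm (H - H') B).
    rewrite heisB commBl.
    move: (heis V B' e) (heis V B e) (heis V' B e) (comm H B) (comm H' B) (0 +i* e).
    move=> x y u p q v.
    by apply/matrixP => i j; rewrite !mxE; ring.
  have -> : w * (1 + 0 * e) + (K + K') * e ^+ 2 + gam * (t + e) =
     (w + gam * t) + (K * 1 * e ^+ 2 + K' * 1 * e ^+ 2 + e * gam) by ring.
  apply: opbD; first exact: (opb_heis _ h Dw).
  apply: opbD.
    by apply: opbB; [apply: hK|apply: hK'] => //; rewrite e0.
  have ye : normc (0 +i* e) = e by rewrite /= expr0n add0r sqrtr_sqr ger0_norm.
  rewrite -[X in opb _ (X * _)]ye; exact: (opbZ _ (hg t te')).
- by rewrite /Inv !(heis0 _ h) !(heis0 _ h') subrr; apply: opb0; rewrite mulr0 addr0.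
- by rewrite t0 lexx.
Qed.

Lemma herm_sum n (I : Type) (r : seq I) (P : pred I) (F : I -> 'M[C]_n) :
  (forall i, F i \is hermsymmx) -> \sum_(i <- r | P i) F i \is hermsymmx.
Proof.
move=> hF; apply/is_hermitianmxP; rewrite expr0 scale1r.
rewrite linear_sum /= map_mx_sum; apply: eq_bigr => i _.
exact: (esym (hermE (hF i))).
Qed.

Lemma finite_common_bound (I : finType) (Q : I -> R -> Prop) :
  (forall i c c', Q i c -> c <= c' -> Q i c') ->
  (forall i, exists2 c, 0 <= c & Q i c) ->
  exists2 c, 0 <= c & forall i, Q i c.
Proof.
move=> mono ex.
have [f fQ] := @boolp.choice I R (fun i c => 0 <= c /\ Q i c)
  (fun i => let: ex_intro2 c c0 Qc := ex i in ex_intro _ c (conj c0 Qc)).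
exists (\sum_i f i) => [|i]; first by apply: sumr_ge0 => i _; have [] := fQ i.
apply: mono (fQ i).2 _; rewrite (bigD1 i) //= lerDl.
by apply: sumr_ge0 => k _; have [] := fQ k.
Qed.

Section LiebRobinson.
Context {n : nat} {I : finType} (h : I -> 'M[C]_n) (J : pred I) (c : R).
Context (ov : rel I) (Delta : nat) (far : nat -> pred I).
Context (A : 'M[C]_n) (V : R -> 'M[C]_n).
Hypothesis c_gt0 : 0 < c.
Hypothesis h_herm : forall z, h z \is hermsymmx.
Hypothesis h_bound : forall z, opb (h z) c.
Hypothesis h_comm : forall z z', ~~ ov z z' -> comm (h z') (h z) = 0.
Hypothesis ov_degree : forall z, (#|[pred z' | ov z z']| <= Delta)%N.
Hypothesis far0 : forall z, far 0 z.
Hypothesis farS : forall j z z', far j.+1 z -> ov z z' -> far j z'.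
Hypothesis A_bound : opb A 1.
Hypothesis A_comm : forall j z, far j.+1 z -> comm A (h z) = 0.
Hypothesis hV : is_evol (\sum_(z | J z) h z) V.

(* [far j z] says that [z] is at least [j] links of the overlap relation away
   from the support of [A]. With [w] the largest value of
   [theta ^- j * |comm (heis V A t) (h z)|], Jacobi's identity gives
   [w' <= (2 c Delta / theta) w]: the part of the Hamiltonian commuting with
   [h z] only rotates the commutator. *)
Lemma lieb_robinson (theta tau : R) : 0 < theta <= 1 -> 0 <= tau ->
  forall t j z, 0 <= t <= tau -> far j z ->
  opb (comm (heis V A t) (h z))
      (4 * c * expR (2 * c * Delta%:R / theta * tau) * theta ^+ j).
Proof.
move=> /andP[th0 th1] tau0 t j0 z0 /andP[t0 tt] farz0.
have c0 := ltW c_gt0; have th0' := ltW th0.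
set a := 2 * c * Delta%:R / theta.
have a0 : 0 <= a by rewrite divr_ge0 ?mulr_ge0.
have [K1 K10 hK1] := heis_taylor hV.
(* Conjugation by the evolution of [G z] preserves bounds, so only the terms overlapping [h z], at
   most [Delta] of them, make its commutator grow. *)
pose G z := \sum_(z' | J z' && ~~ ov z z') h z'.
have Gev z : is_evol (G z) (evolution (G z)).
  by apply: evolution_is_evol; exact: herm_sum.
have [K2 K20 hK2] : exists2 K, 0 <= K & forall (z : I) (B : 'M[C]_n) b e,
    opb B b -> 0 <= e <= 1 ->
    opb (heis (evolution (G z)) B e - B - (0 +i* e) *: comm (G z) B)
        (K * b * e ^+ 2).
  apply: finite_common_bound => [z K K' hK KK' B b e Bb e01|z].
    apply: opb_le (hK B b e Bb e01) _.
    by rewrite !ler_wpM2r ?sqr_ge0 ?(opb_ge0 Bb).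
  exact: heis_taylor (Gev z).
(* The index [z] also runs over terms outside [J], because the bound will be applied to the dynamics
   of a box and to terms leaving it. The cap [j <= j0] keeps the weights above theta^j0, so that one
   constant [K] covers all quadratic errors. *)
pose Inv t w := forall j z, (j <= j0)%N -> far j z ->
  opb (comm (heis V A t) (h z)) (w * theta ^+ j).
pose K := (2 * (K1 * c) + K2 * (2 * c)) / theta ^+ j0.
have K0 : 0 <= K by rewrite divr_ge0 ?exprn_ge0 ?addr_ge0 ?mulr_ge0.
(* The slack is spent rather than sent to 0: the initial value 2c plus [eta] = 2c gives the constant
   4c. *)
suff : Inv t (expR (a * t) * (2 * c + 2 * c)).
  move=> /(_ j0 z0 (leqnn _) farz0) /opb_le; apply.
  rewrite ler_wpM2r ?exprn_ge0// mulrC -mulrDl -natrD ler_wpM2l ?mulr_ge0//.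
  by rewrite ler_expR ler_wpM2l.
apply: (@discrete_gronwall Inv a K tau (2 * c)) => //.
- by rewrite mulr_ge0.
- move=> s w w' hI ww' j z jj fz; apply: opb_le (hI j z jj fz) _.
  by rewrite ler_wpM2r ?exprn_ge0.
- move=> s e w s0 /andP[e0 e1] ste w0 hI j z jj fz.
  rewrite (heisD _ _ _ hV); set B := heis V A s.
  have B1 : opb B 1 by exact: (opb_heis s hV A_bound).
  set H := \sum_(z | J z) h z.
  pose Hz := \sum_(z' | J z' && ov z z') h z'.
  have HE : H = Hz + G z by rewrite /H (bigID (ov z)).
  have GB : comm (comm (G z) B) (h z) = comm (G z) (comm B (h z)).
    apply: comm_jacobi; rewrite comm_suml big1 // => z' /andP[_ nov].
    exact: h_comm.
  have key : comm (heis V B e) (h z) =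
      heis (evolution (G z)) (comm B (h z)) e +
      (comm (heis V B e - B - (0 +i* e) *: comm H B) (h z) -
       (heis (evolution (G z)) (comm B (h z)) e - comm B (h z) -
          (0 +i* e) *: comm (G z) (comm B (h z))) +
       (0 +i* e) *: comm (comm Hz B) (h z)).
    rewrite commBBZ HE (commDl Hz (G z)) (commDl (comm Hz B) (comm (G z) B)) GB.
    move: (heis (evolution (G z)) _ e) (comm (comm Hz B) _) (comm (G z) _) => p u r.
    move: (comm (heis V B e) _) (comm B _) (0 +i* e) => q v y.
    by apply/matrixP => k l; rewrite !mxE; ring.
  (* An overlapping term may be one link closer to [A], at the cost of 1/theta; at level 0 the
     inequality theta <= 1 is used instead. *)
  have nb z' : ov z z' -> opb (comm B (h z')) (w * theta ^+ j / theta).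
    case: j jj fz => [|j] jj fz ozz.
      apply: opb_le (hI 0%N z' (leq0n _) (far0 z')) _.
      by rewrite ler_peMr ?mulr_ge0 ?exprn_ge0// invr_ge1 ?unitfE ?gt_eqF.
    have := hI j z' (ltnW jj) (farS fz ozz).
    by rewrite exprSr mulrA mulfK ?gt_eqF.
  set m := w * theta ^+ j / theta in nb.
  have m0 : 0 <= m by rewrite divr_ge0 ?mulr_ge0 ?exprn_ge0.
  have HzB : opb (comm Hz B) (Delta%:R * m).
    rewrite comm_suml; apply: (@opb_le _ _ _ (\sum_(z' | J z' && ov z z') m)).
      apply: opb_sum => z' /andP[_ ozz]; rewrite commC; apply: opbN; exact: nb.
    have -> : \sum_(z' | J z' && ov z z') m = m *+ #|[pred z' | J z' && ov z z']|.
      by rewrite -sumr_const; apply: eq_bigl.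
    rewrite -mulr_natl ler_wpM2r// ler_nat.
    apply: leq_trans (ov_degree z); apply: subset_leq_card.
    by apply/fintype.subsetP => z' /andP[].
  have ye : normc (0 +i* e) = e by rewrite /= expr0n add0r sqrtr_sqr ger0_norm.
  have e01 : 0 <= e <= 1 by rewrite e0.
  have gb : opb (comm B (h z)) (2 * (1 * c)) by exact: opb_comm B1 (h_bound z).
  rewrite key; apply: (@opb_le _ _ _ (w * theta ^+ j +
     (2 * (K1 * 1 * e ^+ 2 * c) + K2 * (2 * (1 * c)) * e ^+ 2 +
      e * (2 * (Delta%:R * m * c))))).
    apply: opbD; first exact: opb_heis (Gev z) (hI j z jj fz).
    apply: opbD; first apply: opbB.
    - exact: opb_comm (hK1 _ _ _ B1 e01) (h_bound z).
    - exact: hK2 gb e01.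
    rewrite -[X in opb _ (X * _)]ye; apply: opbZ; exact: opb_comm HzB (h_bound z).
  have Kj : (2 * (K1 * c) + K2 * (2 * c)) * e ^+ 2 <= K * e ^+ 2 * theta ^+ j.
    set k := _ + _; have k0 : 0 <= k by rewrite addr_ge0 ?mulr_ge0.
    have -> : K * e ^+ 2 * theta ^+ j = k * e ^+ 2 * (theta ^+ j / theta ^+ j0).
      by rewrite /K -/k; ring.
    rewrite ler_peMr ?mulr_ge0 ?sqr_ge0// ler_pdivlMr ?exprn_gt0// mul1r.
    exact: ler_wiXn2l.
  rewrite (mulrDl _ _ (theta ^+ j)).
  apply: le_trans (lerD (lexx _) Kj).
  rewrite le_eqVlt; apply/orP; left; apply/eqP.
  rewrite /a /m; field; rewrite gt_eqF//.
- rewrite /Inv => j z _ fz; rewrite (heis0 _ hV).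
  case: j fz => [|j] fz.
    rewrite expr0 mulr1 -[c]mul1r; apply: opb_comm => //.
  rewrite (A_comm fz); apply: opb0; rewrite mulr_ge0 ?exprn_ge0 ?mulr_ge0 //.
- by rewrite t0.
- by rewrite mulr_gt0.
Qed.

End LiebRobinson.

End Locality.

(** * Local operators, product states and one-site projections *)

Section Embedding.
Local Open Scope complex_scope. Local Open Scope ring_scope.
Local Open Scope sesquilinear_scope.
Context {R : realType} {d : nat}.
Local Notation C := R[i].
Local Notation normc := Normc.normc.
Implicit Types S T : finType.

Lemma entryP T (A B : 'M[C]_(hdim d T)) :
  (forall s s', entry A s s' = entry B s s') -> A = B.
Proof.
move=> AB; apply/matrixP => i j; rewrite -(enum_valK i) -(enum_valK j).
exact: AB.
Qed.

Lemma entry_op_of T K s s' : entry (op_of K : 'M[C]_(hdim d T)) s s' = K s s'.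
Proof. by rewrite /entry mxE !enum_rankK. Qed.

Lemma sum_config T (F : 'I_(hdim d T) -> C) :
  \sum_i F i = \sum_(s : config d T) F (enum_rank s).
Proof.
rewrite (reindex enum_rank) //; exists enum_val => i _.
  exact: enum_rankK.
exact: enum_valK.
Qed.

Lemma mulmx_config T k (A : 'M[C]_(hdim d T)) (v : 'M[C]_(hdim d T, k)) s j :
  (A *m v) (enum_rank s) j = \sum_u entry A s u * v (enum_rank u) j.
Proof. by rewrite mxE sum_config. Qed.

Section Restriction.
Context {S T : finType} (f : S -> T).

(** The placement [embed] with any finite index type in place of ['I_m], so that boxes, single sites
    and translations are all treated alike. *)
Definition emb (A : 'M[C]_(hdim d S)) : 'M[C]_(hdim d T) :=
  op_of (fun s s' =>
    if [forall y, (y \notin codom f) ==> (s y == s' y)]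
    then A (enum_rank [ffun i => s (f i)]) (enum_rank [ffun i => s' (f i)])
    else 0).

Definition restr (s : config d T) : config d S := [ffun i => s (f i)].

Definition patch (s : config d T) (u : config d S) : config d T :=
  [ffun y => if [pick i | f i == y] is Some i then u i else s y].

Lemma patch_out s u y : y \notin codom f -> patch s u y = s y.
Proof.
move=> yf; rewrite ffunE; case: pickP => // i /eqP fi.
by rewrite -fi codom_f in yf.
Qed.

Lemma emb0 : emb 0 = 0.
Proof.
apply: entryP => s s'; rewrite entry_op_of /entry !mxE.
by case: ifP.
Qed.

Lemma embD A B : emb (A + B) = emb A + emb B.
Proof.
apply: entryP => s s'; rewrite [RHS]mxE -!/(entry _ _ _) !entry_op_of mxE.
by case: ifP => // _; rewrite addr0.
Qed.

Lemma embZ a A : emb (a *: A) = a *: emb A.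
Proof.
apply: entryP => s s'; rewrite [RHS]mxE -!/(entry _ _ _) !entry_op_of mxE.
by case: ifP => // _; rewrite mulr0.
Qed.

Lemma emb_sum (I : Type) (r : seq I) (P : pred I) F :
  emb (\sum_(i <- r | P i) F i) = \sum_(i <- r | P i) emb (F i).
Proof. exact: (big_morph emb embD emb0). Qed.

Lemma emb_adj A : (emb A)^t* = emb (A ^t*).
Proof.
apply: entryP => s s'; rewrite [LHS]mxE mxE -/(entry _ _ _) !entry_op_of.
rewrite !mxE (_ : [forall y, _] = [forall y, (y \notin codom f) ==> (s y == s' y)]).
  by case: ifP => // _; rewrite rmorph0.
by apply: eq_forallb => y; rewrite eq_sym.
Qed.

Hypothesis fI : injective f.

Lemma patch_in s u i : patch s u (f i) = u i.
Proof.
rewrite ffunE; case: pickP => [j /eqP/fI -> //|/(_ i)].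
by rewrite eqxx.
Qed.

Lemma restr_patch s u : restr (patch s u) = u.
Proof. by apply/ffunP => i; rewrite ffunE patch_in. Qed.

Lemma patch_eq (s : config d T) (u : config d S) (s' : config d T) :
  (forall i, s' (f i) = u i) -> (forall y, y \notin codom f -> s' y = s y) ->
  patch s u = s'.
Proof.
move=> h1 h2; apply/ffunP => y; have [/codomP[i ->]|yf] := boolP (y \in codom f).
  by rewrite patch_in h1.
by rewrite patch_out// h2.
Qed.

Lemma patch_restr s : patch s (restr s) = s.
Proof. by apply: patch_eq => // i; rewrite ffunE. Qed.

Lemma patch_patch s u w : patch (patch s u) w = patch s w.
Proof.
by apply: patch_eq => [i|y yf]; rewrite ?patch_in// !patch_out.
Qed.

(** Row [s] is supported on the configurations agreeing with [s] off the image of [f], and these are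
    the patches of [s]. *)
Lemma sum_emb A s (G : config d T -> C) :
  \sum_u entry (emb A) s u * G u =
  \sum_w entry A (restr s) w * G (patch s w).
Proof.
rewrite (eq_bigr (fun u : config d T =>
  if [forall y, (y \notin codom f) ==> (s y == u y)]
  then entry A (restr s) (restr u) * G u else 0)); last first.
  by move=> u _; rewrite entry_op_of; case: ifP => //; rewrite mul0r.
rewrite -big_mkcond (reindex_onto (patch s) restr) /=; last first.
  move=> u /forallP h; apply: patch_eq => [i|y yf]; first by rewrite ffunE.
  by have := h y; rewrite yf /= => /eqP.
apply: eq_big => [w|w _]; last by rewrite restr_patch.
rewrite restr_patch eqxx andbT; apply/forallP => y; apply/implyP => yf.
by rewrite patch_out.
Qed.

Lemma emb_mulmx k A (v : 'M[C]_(hdim d T, k)) s j :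
  (emb A *m v) (enum_rank s) j =
  \sum_w entry A (restr s) w * v (enum_rank (patch s w)) j.
Proof. by rewrite mulmx_config sum_emb. Qed.

Lemma mulmx_ext (A B : 'M[C]_(hdim d T)) :
  (forall (v : 'M[C]_(hdim d T)) s j,
     (A *m v) (enum_rank s) j = (B *m v) (enum_rank s) j) -> A = B.
Proof.
move=> h; rewrite -(mulmx1 A) -(mulmx1 B); apply/matrixP => i j.
by rewrite -(enum_valK i); exact: h.
Qed.

Lemma embM A B : emb (A *m B) = emb A *m emb B.
Proof.
apply: mulmx_ext => v s j; rewrite -mulmxA !emb_mulmx.
under [RHS]eq_bigr do rewrite emb_mulmx mulr_sumr.
rewrite exchange_big /=; apply: eq_bigr => w _.
rewrite /entry mulmx_config mulr_suml; apply: eq_bigr => u _.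
by rewrite restr_patch patch_patch mulrA.
Qed.

Lemma emb1 : emb 1%:M = 1%:M.
Proof.
apply: mulmx_ext => v s j; rewrite emb_mulmx mul1mx.
rewrite (bigD1 (restr s)) //= big1 ?addr0 => [|w ws].
  by rewrite /entry mxE eqxx mul1r patch_restr.
rewrite /entry mxE (inj_eq enum_rank_inj) eq_sym (negPf ws).
by rewrite mul0r.
Qed.

(* The map [(s, u) |-> (patch s u, restr s)] is an involution. *)
Lemma sum_patch (G : config d T -> R) :
  \sum_s \sum_u G (patch s u) = (hdim d S)%:R * \sum_s G s.
Proof.
rewrite (pair_big xpredT xpredT) /=.
rewrite (reindex (fun p : config d T * config d S => (patch p.1 p.2, restr p.1))) /=.
  under eq_bigr do rewrite patch_patch patch_restr.
  rewrite -(pair_big xpredT xpredT (fun s (u : config d S) => G s)) /= mulr_sumr.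
  by apply: eq_bigr => s _; rewrite sumr_const mulr_natl.
exists (fun p : config d T * config d S => (patch p.1 p.2, restr p.1)) => -[s u] _ /=;
  by rewrite restr_patch patch_patch patch_restr.
Qed.

(** Fixing the configuration off the image of [f] cuts [v] into slices [vs], and the bound on [A] is
    applied to each. Summing over all [s] counts every slice [hdim d S] times on both sides. *)
Lemma opb_emb A c : opb A c -> opb (emb A) c.
Proof.
move=> Ac; have c0 := opb_ge0 Ac; split=> // v.
rewrite -(@ler_pXn2r _ 2) ?nnegrE ?mulr_ge0 ?vnorm_ge0// exprMn !vnorm_sum.
have sc (F : 'I_(hdim d T) -> R) : \sum_i F i = \sum_s F (enum_rank s).
  rewrite (reindex enum_rank) //; exists enum_val => i _.
    exact: enum_rankK.
  exact: enum_valK.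
have sc' (F : 'I_(hdim d S) -> R) : \sum_i F i = \sum_s F (enum_rank s).
  rewrite (reindex enum_rank) //; exists enum_val => i _.
    exact: enum_rankK.
  exact: enum_valK.
(* Without configurations on [S] there are none on [T]; otherwise the factor [hdim d S] can be
   cancelled. *)
have [N0|N0] := posnP (hdim d S).
  by rewrite !sc !big1 ?mulr0// => s _; have := card0_eq N0 (restr s).
rewrite -(@ler_pM2l _ (hdim d S)%:R) ?ltr0n// mulrCA !sc -!sum_patch mulr_sumr.
apply: ler_sum => s _.
pose vs : 'cV[C]_(hdim d S) := \col_i v (enum_rank (patch s (enum_val i))) 0.
have : vnorm (A *m vs) ^+ 2 <= c ^+ 2 * vnorm vs ^+ 2.
  rewrite -exprMn ler_pXn2r ?nnegrE ?mulr_ge0 ?vnorm_ge0//.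
  exact: opb_bound Ac vs.
rewrite !vnorm_sum !sc'.
congr (_ <= _).
  apply: eq_bigr => u _; congr (normc _ ^+ 2).
  rewrite emb_mulmx mulmx_config restr_patch; apply: eq_bigr => w _.
  by rewrite mxE enum_rankK patch_patch.
by congr (_ * _); apply: eq_bigr => u _; rewrite mxE enum_rankK.
Qed.

Lemma emb_herm A : A \is hermsymmx -> emb A \is hermsymmx.
Proof.
move=> Ah; apply/is_hermitianmxP; rewrite expr0 scale1r.
by rewrite [RHS]emb_adj (hermE Ah).
Qed.

(** Embedding respects products, adjoints, the identity and norm bounds, so the defining properties
    transfer without returning to the exponential series. *)
Lemma emb_is_evol H V : is_evol H V -> is_evol (emb H) (fun t => emb (V t)).
Proof.
move=> [V0 VD Va [K K0 hK]]; split.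
- by rewrite V0 emb1.
- by move=> s t; rewrite VD embM.
- by move=> t; rewrite emb_adj Va.
exists K => // t; have := opb_emb (hK t).
by rewrite !embD embZ -[- 1%:M]scaleN1r embZ emb1 scaleN1r.
Qed.

Lemma emb_heis V A t :
  emb (heis V A t) = heis (fun u => emb (V u)) (emb A) t.
Proof. by rewrite /heis !embM. Qed.

End Restriction.

Lemma emb_comp (S T U : finType) (g : S -> T) (f : T -> U) (A : 'M[C]_(hdim d S)) :
  injective f -> injective g -> emb f (emb g A) = emb (f \o g) A.
Proof.
move=> fI gI; have fgI : injective (f \o g) by exact: inj_comp.
apply: mulmx_ext => v s j; rewrite !emb_mulmx// sum_emb//.
apply: eq_bigr => w _; congr (entry _ _ _ * v (enum_rank _) _).
  by apply/ffunP => i; rewrite !ffunE.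
apply: patch_eq => // [i|y yf].
  have [/codomP[k ->]|ig] := boolP (i \in codom g).
    by rewrite patch_in// -(patch_in fgI s).
  rewrite [RHS]patch_out// [RHS]ffunE patch_out//; apply/codomP => -[k /= /fI ik].
  by rewrite ik codom_f in ig.
by rewrite patch_out//; apply/codomP => -[k /= yk]; rewrite yk codom_f in yf.
Qed.

Lemma eq_emb (S T : finType) (f g : S -> T) (A : 'M[C]_(hdim d S)) :
  f =1 g -> emb f A = emb g A.
Proof. by move=> fg; congr emb; apply/funext. Qed.

Lemma emb_commute (S S' T : finType) (f : S -> T) (g : S' -> T)
    (A : 'M[C]_(hdim d S)) (B : 'M[C]_(hdim d S')) :
  injective f -> injective g -> (forall i j, f i != g j) ->
  emb f A *m emb g B = emb g B *m emb f A.
Proof.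
move=> fI gI fg.
have out1 i : f i \notin codom g.
  by apply/codomP; case=> j e; have := fg i j; rewrite e eqxx.
have out2 j : g j \notin codom f.
  by apply/codomP; case=> i e; have := fg i j; rewrite e eqxx.
apply: mulmx_ext => v s j; rewrite -!mulmxA !emb_mulmx//.
under eq_bigr do rewrite emb_mulmx// mulr_sumr.
under [RHS]eq_bigr do rewrite emb_mulmx// mulr_sumr.
rewrite exchange_big /=; apply: eq_bigr => w _; apply: eq_bigr => u _.
have -> : restr g (patch f s u) = restr g s.
  by apply/ffunP => i; rewrite [LHS]ffunE [RHS]ffunE patch_out.
have -> : restr f (patch g s w) = restr f s.
  by apply/ffunP => i; rewrite [LHS]ffunE [RHS]ffunE patch_out.
rewrite mulrCA; congr (_ * (_ * v (enum_rank _) _)).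
apply: patch_eq => // [i|y yg].
  by rewrite patch_out// patch_in.
have [/codomP[k ->]|yf] := boolP (y \in codom f); first by rewrite !patch_in.
by rewrite !patch_out.
Qed.

Section Product.
Context (psi : 'cV[C]_d) (psi1 : vnorm psi = 1).

Local Notation Psi T := (product_state (T := T) psi).
Definition proj T : 'M[C]_(hdim d T) := Psi T *m (Psi T) ^t*.

Lemma product_stateE T (s : config d T) :
  Psi T (enum_rank s) 0 = \prod_y psi (s y) 0.
Proof. by rewrite mxE; apply: eq_bigr => y _; rewrite enum_rankK. Qed.

Lemma dot_config T (u v : 'cV[C]_(hdim d T)) :
  dot u v = \sum_(s : config d T) (u (enum_rank s) 0)^* * v (enum_rank s) 0.
Proof. by rewrite dotE sum_config. Qed.

Lemma dot_product_state T : dot (Psi T) (Psi T) = 1.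
Proof.
rewrite dot_config.
have psiE : \sum_a (psi a 0)^* * psi a 0 = 1.
  by rewrite -dotE -vnormE psi1 expr1n.
transitivity (\prod_(y : T) \sum_a (psi a 0)^* * psi a 0); last first.
  by rewrite big1.
rewrite bigA_distr_bigA /=; apply: eq_bigr => s _.
by rewrite product_stateE rmorph_prod -big_split.
Qed.

Lemma vnorm_product_state T : vnorm (Psi T) = 1.
Proof.
apply/eqP; rewrite -(@eqrXn2 _ 2) ?vnorm_ge0//; apply/eqP/complexI.
by rewrite vnormE dot_product_state expr1n.
Qed.

Lemma proj_mul T (v : 'cV[C]_(hdim d T)) : proj T *m v = dot (Psi T) v *: Psi T.
Proof.
rewrite /proj -mulmxA [_ *m v]mx11_scalar mul_mx_scalar.
exact: erefl.
Qed.

Lemma proj_adj T : (proj T)^t* = proj T.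
Proof. by rewrite /proj trmx_mul map_mxM trmxCK. Qed.

Lemma proj_sandwich T A : proj T *m A *m proj T = dot (Psi T) (A *m Psi T) *: proj T.
Proof.
rewrite {2}/proj mulmxA -(mulmxA (proj T)) proj_mul -scalemxAl.
exact: erefl.
Qed.

(** The amplitude of a patched configuration splits into a factor on [S], fixed by the projection,
    and one that it does not see. *)
Lemma emb_proj_product S T (f : S -> T) : injective f ->
  emb f (proj S) *m Psi T = Psi T.
Proof.
move=> fI; apply/colP => k; rewrite -(enum_valK k); move: (enum_val k) => s.
rewrite emb_mulmx//.
pose rest := \prod_(y | y \notin codom f) psi (s y) 0.
have PE u : Psi T (enum_rank (patch f s u)) 0 = Psi S (enum_rank u) 0 * rest.
  rewrite !product_stateE (bigID (fun y => y \in codom f)) /=; congr (_ * _).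
    have uf : uniq (codom f) by rewrite codomE map_inj_uniq ?enum_uniq.
    rewrite -(big_uniq _ uf) codomE big_map big_enum.
    by apply: eq_bigr => i _; rewrite patch_in.
  by apply: eq_bigr => y yf; rewrite patch_out.
rewrite -[in RHS](patch_restr fI s) PE.
under eq_bigr do rewrite PE mulrA.
rewrite -mulr_suml; congr (_ * _).
transitivity ((proj S *m Psi S) (enum_rank (restr f s)) 0).
  by rewrite mulmx_config.
by rewrite proj_mul dot_product_state scale1r.
Qed.

(* Sandwiching [emb f A] between two copies of the projection [emb f (proj S)],
   which fixes the product state and commutes with [B], replaces it by a scalar. *)
Lemma factorize S T (f : S -> T) A (B : 'M[C]_(hdim d T)) : injective f ->
  emb f (proj S) *m B = B *m emb f (proj S) ->
  dot (Psi T) (emb f A *m B *m Psi T) =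
  dot (Psi S) (A *m Psi S) * dot (Psi T) (B *m Psi T).
Proof.
move=> fI QB; set Q := emb f (proj S) in QB *.
have QPsi : Q *m Psi T = Psi T by exact: emb_proj_product.
have QQ : Q ^t* = Q by rewrite /Q emb_adj proj_adj.
rewrite -{1 2}QPsi -{1}QQ -dot_adj !mulmxA -(mulmxA _ B) -QB !mulmxA.
rewrite -!embM// proj_sandwich embZ -!scalemxAl dotZr; congr (_ * _).
rewrite -/Q -mulmxA dot_adj QQ QPsi.
exact: erefl.
Qed.

Lemma dot_emb S T (f : S -> T) A : injective f ->
  dot (Psi T) (emb f A *m Psi T) = dot (Psi S) (A *m Psi S).
Proof.
move=> fI; have := @factorize S T f A 1%:M fI.
by rewrite !mul1mx !mulmx1 dot_product_state mulr1; apply.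
Qed.


Definition at_site T (x : T) (_ : 'I_1) : T := x.

Lemma at_site_inj T (x : T) : injective (at_site x).
Proof. by move=> i j _; rewrite !ord1. Qed.

Definition site_proj T (x : T) := emb (at_site x) (proj 'I_1).

Lemma emb_site_proj S T (f : S -> T) x : injective f ->
  emb f (site_proj x) = site_proj (f x).
Proof. by move=> fI; rewrite /site_proj emb_comp//; exact: at_site_inj. Qed.

Lemma site_projPsi T (x : T) : site_proj x *m Psi T = Psi T.
Proof. exact: (emb_proj_product (@at_site_inj T x)). Qed.

Lemma site_proj_adj T (x : T) : (site_proj x)^t* = site_proj x.
Proof. by rewrite /site_proj emb_adj proj_adj. Qed.

Lemma site_proj_idem T (x : T) : site_proj x *m site_proj x = site_proj x.
Proof.
rewrite /site_proj -embM; last exact: at_site_inj.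
congr emb; rewrite {2}/proj mulmxA proj_mul dot_product_state scale1r.
exact: erefl.
Qed.

Lemma opb_site_proj T (x : T) : opb (site_proj x) 1.
Proof. exact: (opb_proj_idem (site_proj_adj x) (site_proj_idem x)). Qed.

Lemma site_proj_dot T (x : T) v :
  dot v (site_proj x *m v) = ((vnorm (site_proj x *m v)) ^+ 2)%:C.
Proof. exact: (proj_dot v (site_proj_adj x) (site_proj_idem x)). Qed.

Lemma site_proj_action T (x : T) (v : 'cV[C]_(hdim d T)) s :
  (site_proj x *m v) (enum_rank s) 0 =
  psi (s x) 0 * \sum_c (psi c 0)^* * v (enum_rank (update x c s)) 0.
Proof.
rewrite emb_mulmx; last exact: at_site_inj.
have P1 (w : config d 'I_1) : Psi 'I_1 (enum_rank w) 0 = psi (w 0) 0.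
  by rewrite product_stateE big_ord1.
rewrite mulr_sumr (reindex (fun c => [ffun _ : 'I_1 => c])) /=.
  apply: eq_bigr => c _; rewrite /entry /proj !mxE big_ord1 !mxE.
  have := P1 (restr (at_site x) s); rewrite mxE => ->.
  have := P1 [ffun=> c]; rewrite mxE => ->; rewrite !ffunE mulrA.
  congr (_ * v (enum_rank _) 0); apply/ffunP => y.
  have [yx|yx] := eqVneq y x.
    rewrite [RHS]ffunE yx eqxx -[x in LHS]/(at_site x 0) patch_in ?ffunE//.
    exact: at_site_inj.
  rewrite [RHS]ffunE (negPf yx) patch_out//; apply/codomP; case=> i; exact/eqP.
exists (fun w : config d 'I_1 => w 0) => w _; first by rewrite ffunE.
by apply/ffunP => i; rewrite ffunE ord1.
Qed.

Lemma bracket_site_op T (x : T) (rho : 'M[C]_d) :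
  bracket (Psi T) (site_op x rho) (Psi T) =
  \sum_a \sum_c (psi a 0)^* * rho a c * psi c 0.
Proof.
pose rho1 : 'M[C]_(hdim d 'I_1) :=
  op_of (fun s s' : config d 'I_1 => rho (s 0) (s' 0)).
have -> : site_op x rho = emb (at_site x) rho1.
  apply: entryP => s s'; rewrite !entry_op_of.
  rewrite (eq_forallb (P2 := fun y => (y \notin codom (at_site x)) ==> (s y == s' y))).
    by case: ifP => // _; rewrite -/(entry _ _ _) entry_op_of !ffunE.
  move=> y; congr (~~ _ ==> _); apply/eqP/codomP => [->|[i ->//]].
  by exists 0.
rewrite /bracket -mulmxA -/(dot _ _) dot_emb; last exact: at_site_inj.
have E (G : config d 'I_1 -> C) : \sum_w G w = \sum_c G [ffun=> c].
  rewrite (reindex (fun c => [ffun _ : 'I_1 => c])) //=.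
  exists (fun w : config d 'I_1 => w 0) => w _; first by rewrite ffunE.
  by apply/ffunP => i; rewrite ffunE ord1.
rewrite dot_config E; apply: eq_bigr => a _.
rewrite mulmx_config E mulr_sumr; apply: eq_bigr => c _.
by rewrite entry_op_of !product_stateE !big_ord1 !ffunE mulrA.
Qed.

Lemma overlap_reduced_density T (H : 'M[C]_(hdim d T)) (x : T) t :
  let phi := evolution H t *m Psi T in
  complex.Re (bracket (Psi T) (site_op x (reduced_density H (Psi T) x t)) (Psi T)) =
  vnorm (site_proj x *m phi) ^+ 2.
Proof.
move=> phi; rewrite bracket_site_op.
(* The order of indices in the partial trace produces the conjugate of <phi, P phi>, which is
   real. *)
suff -> : \sum_a \sum_c (psi a 0)^* * reduced_density H (Psi T) x t a c * psi c 0 =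
    (dot phi (site_proj x *m phi))^*.
  by rewrite site_proj_dot; exact: erefl.
rewrite dot_config rmorph_sum /=.
rewrite [RHS](partition_big (fun s : config d T => s x) xpredT) //=.
apply: eq_bigr => a _.
under eq_bigr do rewrite mxE mulr_sumr mulr_suml.
rewrite exchange_big /=; apply: eq_bigr => s /eqP sx.
rewrite site_proj_action sx !rmorphM /= conjCK rmorph_sum !mulr_sumr.
apply: eq_bigr => c _.
have -> : evolution H t *m Psi T *m (Psi T)^t* *m (evolution H t)^t* = phi *m phi^t*.
  by rewrite /phi trmx_mul map_mxM !mulmxA.
clearbody phi; rewrite /entry mxE big_ord1 !mxE rmorphM /= conjCK.
ring.
Qed.

Lemma update_update T (x : T) a c (s : config d T) :
  update x c (update x a s) = update x c s.
Proof. by apply/ffunP => y; rewrite !ffunE; case: eqP. Qed.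

(** Invariance under the projection at x allows the value at x to be replaced by a reference [c0] of
    nonzero amplitude, up to a ratio of amplitudes of [psi]. Doing so at every site leaves one
    unknown amplitude, that of the constant configuration. *)
Lemma all_site_proj_fixed T (phi : 'cV[C]_(hdim d T)) :
  (forall x, site_proj x *m phi = phi) -> exists a, phi = a *: Psi T.
Proof.
move=> fix_phi.
have [c0 c00] : exists c, psi c 0 != 0.
  apply/existsP; rewrite -[X in is_true X]negbK; apply/negP => /existsPn h.
  have : vnorm psi = 0.
    suff -> : psi = 0 by exact: vnorm0.
    by apply/colP => i; rewrite mxE; apply/eqP; have := h i; rewrite negbK.
  by rewrite psi1 => /eqP; rewrite oner_eq0.
pose upd (r : seq T) (s : config d T) : config d T :=
  [ffun y => if y \in r then c0 else s y].
have step x s : phi (enum_rank s) 0 * psi c0 0 =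
    psi (s x) 0 * phi (enum_rank (update x c0 s)) 0.
  rewrite -{1 2}(fix_phi x) !site_proj_action ffunE eqxx.
  under [in RHS]eq_bigr => c _ do rewrite update_update.
  by rewrite -mulrA; congr (_ * _); rewrite mulrC.
have steps (r : seq T) s : uniq r ->
    phi (enum_rank s) 0 * psi c0 0 ^+ size r =
    (\prod_(y <- r) psi (s y) 0) * phi (enum_rank (upd r s)) 0.
  elim: r s => [|x r IH] s /=.
    move=> _; rewrite big_nil expr0 mulr1 mul1r; congr (phi (enum_rank _) 0).
    by apply/ffunP => y; rewrite ffunE.
  move=> /andP[xr ur]; rewrite exprSr mulrA IH// big_cons -mulrA (step x).
  have -> : update x c0 (upd r s) = upd (x :: r) s.
    apply/ffunP => y; rewrite !ffunE inE; case: (eqVneq y x) => //.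
  by rewrite ffunE (negPf xr) mulrCA mulrA.
exists ((psi c0 0 ^+ #|T|)^-1 * phi (enum_rank ([ffun=> c0] : config d T)) 0).
apply/colP => k; rewrite -(enum_valK k); move: (enum_val k) => s.
have := steps (enum T) s (enum_uniq T).
have -> : upd (enum T) s = [ffun=> c0].
  by apply/ffunP => y; rewrite !ffunE mem_enum.
rewrite big_enum /= -product_stateE -cardE => h.
apply: (@mulIf _ (psi c0 0 ^+ #|T|)); first by rewrite expf_neq0.
by rewrite h [in RHS]mxE mulrC -!mulrA [in RHS]mulrC -!mulrA mulfV ?expf_neq0// mulr1 mulrC.
Qed.

End Product.

End Embedding.

(** * Shifts on the torus *)

Section Torus.
Local Notation shift := Defs.shift.
Context {D L : nat}.
Implicit Types (x y : torus D L) (v w : lattice D).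

Lemma shiftE x v j : shift x v j = x j + Zp1 *~ v j.
Proof. by rewrite ffunE. Qed.

Lemma shiftD x v w : shift (shift x v) w = shift x (v + w).
Proof. by apply/ffunP => j; rewrite !ffunE mulrzDr addrA. Qed.

Lemma shift0 x : shift x 0 = x.
Proof. by apply/ffunP => j; rewrite !ffunE mulr0z addr0. Qed.

Lemma shift_addl x y v : shift (x + y) v = x + shift y v.
Proof. by apply/ffunP => j; rewrite !ffunE addrA. Qed.

Lemma shiftK v : cancel (fun x => shift x v) (fun x => shift x (- v)).
Proof. by move=> x; rewrite shiftD subrr shift0. Qed.

Lemma fits_inj m (s : 'I_m -> lattice D) : fits L s ->
  forall x, injective (fun i => shift x (s i)).
Proof.
move=> [_ sI] x i j; rewrite -[x]addr0 !shift_addl => /addrI; exact: sI.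
Qed.

Lemma mulz_Zp1 (k : nat) : (0 < L)%N -> (k < L)%N ->
  nat_of_ord (Zp1 *~ k%:Z : 'I_L.-1.+1) = k.
Proof.
move=> L0 kL; rewrite -pmulrn Zp_mulrn /= modnMml mul1n prednK// modn_small//.
Qed.

End Torus.

(** * Translation invariance and the one-site overlap *)

Section Hamiltonian.
Local Notation shift := Defs.shift.
Local Open Scope complex_scope. Local Open Scope ring_scope.
Local Open Scope sesquilinear_scope.
Context {R : realType} {D d m : nat} (s : 'I_m -> lattice D).
Local Notation C := R[i].
Local Notation normc := Normc.normc.
Context (h0 : 'M[C]_(hdim d 'I_m)) (psi : 'cV[C]_d).
Hypothesis psi1 : vnorm psi = 1.
Hypothesis h0_herm : h0 \is hermsymmx.

Definition term_sites L (x : torus D L) (i : 'I_m) := shift x (s i).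

Local Notation H L := (hamiltonian L s h0).
Local Notation Psi L := (product_state (T := torus D L) psi).
Local Notation P x := (site_proj psi x).

Lemma hamiltonianE L : H L = \sum_(x : torus D L) emb (term_sites x) h0.
Proof. by []. Qed.

Lemma hamiltonian_herm L : fits L s -> H L \is hermsymmx.
Proof.
move=> fL; apply: herm_sum => x; apply: emb_herm => //.
Qed.

Lemma hamiltonian_evol L : fits L s -> is_evol (H L) (evolution (H L)).
Proof. by move=> fL; apply: evolution_is_evol; exact: hamiltonian_herm. Qed.

Definition translation L (a : torus D L) (y : torus D L) := a + y.

Lemma translation_inj L (a : torus D L) : injective (translation a).
Proof. exact: addrI. Qed.

Lemma hamiltonian_translation L (a : torus D L) : fits L s ->
  emb (translation a) (H L) = H L.
Proof.
move=> fL; rewrite hamiltonianE emb_sum [RHS](reindex_inj (@addrI _ a)).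
apply: eq_bigr => x _; rewrite emb_comp; [|exact: translation_inj|exact: fits_inj fL x].
by apply: eq_emb => i; rewrite /= /translation /term_sites shift_addl.
Qed.

Lemma evolution_translation L (a : torus D L) : fits L s ->
  (fun t => emb (translation a) (evolution (H L) t)) = evolution (H L).
Proof.
move=> fL; have ev := hamiltonian_evol fL.
have := emb_is_evol (@translation_inj L a) ev.
rewrite (hamiltonian_translation a fL) => ev'; apply/funext => t.
exact: evol_unique ev' ev t.
Qed.

(** The quantity <psi|rho_x(t)|psi> under the logarithm of the rate, by
    [overlap_reduced_density]. *)
Definition overlap L (x : torus D L) t : R :=
  vnorm (P x *m (evolution (H L) t *m Psi L)) ^+ 2.

Lemma overlap_heis L (x : torus D L) t : fits L s ->
  (overlap x t)%:C = dot (Psi L) (heis (evolution (H L)) (P x) t *m Psi L).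
Proof.
move=> fL; have ev := hamiltonian_evol fL.
rewrite /overlap -(site_proj_dot psi1) /heis -(evol_adj ev) -!mulmxA.
by rewrite [RHS]dot_adj trmxCK.
Qed.

(** Translation by [y - x] fixes the state and the dynamics and carries the projection at x to the
    one at y. *)
Lemma overlap_translation L (x y : torus D L) t : fits L s -> overlap x t = overlap y t.
Proof.
move=> fL; apply: complexI.
apply: etrans (overlap_heis x t fL) _; apply: etrans _ (esym (overlap_heis y t fL)).
have tI := @translation_inj L (y - x).
apply: etrans (esym (dot_emb psi1 _ tI)) _.
rewrite (emb_heis tI) (evolution_translation _ fL) (emb_site_proj _ _ tI).
by rewrite /translation subrK.
Qed.

Lemma vnorm_evolution L t : fits L s -> vnorm (evolution (H L) t *m Psi L) = 1.
Proof.
move=> fL; rewrite vnorm_unitary ?vnorm_product_state//.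
exact: evol_unitary t (hamiltonian_evol fL).
Qed.

Lemma overlap_ge0 L (x : torus D L) t : 0 <= overlap x t.
Proof. exact: sqr_ge0. Qed.

Lemma overlap_le1 L (x : torus D L) t : fits L s -> overlap x t <= 1.
Proof.
move=> fL; rewrite /overlap expr_le1 ?vnorm_ge0//.
have := opb_bound (opb_site_proj psi1 x) (evolution (H L) t *m Psi L).
by rewrite vnorm_evolution// mul1r.
Qed.

(** By translation invariance the overlap is 1 at every site y, so phi - P phi, whose squared norm
    is 1 - overlap, vanishes for each one-site projection P. *)
Lemma overlap_eq1 L (x : torus D L) t : fits L s -> 1 <= overlap x t ->
  exists a, evolution (H L) t *m Psi L = a *: Psi L.
Proof.
move=> fL ov; apply: (all_site_proj_fixed psi1) => y.
set phi := evolution (H L) t *m Psi L.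
apply: subr0_eq; apply: vnorm_eq0; apply/eqP; rewrite -sqrf_eq0 eq_le sqr_ge0 andbT.
have pd := proj_dot phi (site_proj_adj psi y) (site_proj_idem psi1 y).
have pd' : dot (P y *m phi) phi = dot phi (P y *m phi).
  by rewrite [RHS]dot_adj site_proj_adj.
rewrite -lecR vnormE dotBr !dotBl pd' pd -!vnormE vnorm_evolution// expr1n.
rewrite subrr sub0r opprB subr_le0 lecR.
by move: ov; rewrite (overlap_translation x y t fL).
Qed.

Lemma local_rate_overlap L (x : torus D L) t :
  local_rate (H L) (Psi L) x t = (- lne (overlap x t)%:E)%E.
Proof. by rewrite /local_rate (overlap_reduced_density psi1). Qed.

End Hamiltonian.

(** * Times at which the state returns up to a phase *)

Section PhaseTimes.
Local Open Scope complex_scope. Local Open Scope ring_scope.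
Local Open Scope classical_set_scope.
Local Open Scope sesquilinear_scope.
Context {R : realType}.
Local Notation C := R[i].
Local Notation normc := Normc.normc.

(** Rounding t/e down is injective on such a set. *)
Lemma separated_countable (G : set R) e : 0 < e ->
  (forall t, G t -> 0 < t) ->
  (forall x y, G x -> G y -> x <= y -> y - x < e -> x = y) -> countable G.
Proof.
move=> e0 Gpos Gsep; apply/countable_injP; exists (fun t => Num.truncn (t / e)).
move=> x y; rewrite !inE => Gx Gy.
wlog xy : x y Gx Gy / x <= y.
  by move=> h; have [/h|/ltW /h h' /esym/h' ->] := leP x y; [apply|..].
move=> tE; apply: Gsep => //.
have xe : 0 <= x / e by apply/ltW/divr_gt0 => //; exact: Gpos.
have ye : 0 <= y / e by apply/ltW/divr_gt0 => //; exact: Gpos.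
have /andP[x1 _] := truncn_itv xe; have /andP[_ y2] := truncn_itv ye.
rewrite -[e in ltRHS]mul1r -(ltr_pdivrMr _ _ e0) mulrBl.
move: x1 y2; rewrite tE -natr1; lra.
Qed.

Context {n : nat} (H : 'M[C]_n) (V : R -> 'M[C]_n) (Psi : 'cV[C]_n).
Hypothesis hV : is_evol H V.
Hypothesis Psi1 : vnorm Psi = 1.

Definition phase_time t := exists a, V t *m Psi = a *: Psi.

(* The phase times form a subgroup of the reals, which is discrete unless [Psi]
   is an eigenstate. *)
Lemma phase_timeB t u : phase_time t -> phase_time u -> phase_time (t - u).
Proof.
move=> [a ta] [b ub].
have Psi_b : Psi = b *: (V (- u) *m Psi).
  by rewrite scalemxAr -ub mulmxA (evol_inv _ hV) mul1mx.
have b0 : b != 0.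
  apply/eqP => b0; move: Psi1; rewrite Psi_b b0 scale0r vnorm0 => /esym/eqP.
  by rewrite oner_eq0.
exists (a / b); rewrite addrC (evolD hV) -mulmxA ta -scalemxAr.
by rewrite [in RHS]Psi_b scalerA divfK.
Qed.

(** Let [w] be the part of H Psi orthogonal to Psi. At a phase time t, pairing [w] with the Taylor
    remainder of V t Psi leaves it|w|^2, while the remainder has norm at most K t^2. Hence |w| <= K
    t, and arbitrarily small phase times force w = 0. *)
Lemma not_eigenstate_separated : ~ is_eigenstate H Psi ->
  exists2 e, 0 < e & forall t, phase_time t -> 0 < t -> e <= t.
Proof.
move=> neig; apply: contrapT => nex; apply: neig.
have small e : 0 < e -> exists2 t, phase_time t & 0 < t < e.
  move=> e0; apply: contrapT => h; apply: nex; exists e => // t pt t0.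
  by rewrite leNgt; apply/negP => te; apply: h; exists t => //; rewrite t0.
split.
  by apply/eqP => P0; move: Psi1; rewrite P0 vnorm0 => /esym/eqP; rewrite oner_eq0.
exists (dot Psi (H *m Psi)); apply: subr0_eq; set w := _ - _.
have wperp : dot Psi w = 0.
  by rewrite /w dotDr -scaleNr dotZr -vnormE Psi1 expr1n mulr1 subrr.
apply: vnorm_eq0; apply/eqP; rewrite eq_le vnorm_ge0 andbT leNgt; apply/negP => w0.
have [K K0 hK] := evol_taylor hV.
have K1 : 0 < K + 1 by rewrite ltr_wpDl.
have [t [a ta] /andP[t0 te]] := small _ (divr_gt0 w0 K1).
have := opb_bound (hK t) Psi; rewrite Psi1 mulr1 => h1.
pose y := (V t - 1%:M + (0 +i* t) *: H) *m Psi.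
have yE : dot w y = (0 +i* t) * dot w w.
  have Hw : H *m Psi = w + dot Psi (H *m Psi) *: Psi by rewrite subrK.
  rewrite /y mulmxDl mulmxBl ta mul1mx -scalemxAl Hw.
  rewrite -{2}(scale1r Psi) -scalerBl scalerDr scalerA dotDr dotZr.
  rewrite dotDr !dotZr -(dot_conj Psi w) wperp conjC0 !mulr0 addr0 add0r.
  exact: erefl.
have := cauchy_schwarz w y; rewrite yE Normc.normcM -vnormE.
have -> : normc (0 +i* t) = t by rewrite /= expr0n add0r sqrtr_sqr gtr0_norm.
have -> : normc ((vnorm w ^+ 2)%:C) = vnorm w ^+ 2.
  by rewrite /= expr0n addr0 sqrtr_sqr ger0_norm ?sqr_ge0.
rewrite expr2 mulrCA ler_pM2l// => h2.
have := le_trans h2 h1; rewrite expr2 mulrA mulrC ler_pM2r// => h3.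
move: te; rewrite ltr_pdivlMr// => te.
suff Kt : K * t < vnorm w by have := le_lt_trans h3 Kt; rewrite ltxx.
by apply: le_lt_trans te; rewrite mulrDr mulr1 mulrC lerDl ltW.
Qed.

Lemma phase_times_countable : ~ is_eigenstate H Psi ->
  countable [set t | 0 < t /\ phase_time t].
Proof.
move=> /not_eigenstate_separated [e e0 he].
apply: (separated_countable e0) => [t []//|x y [x0 px] [y0 py] xy yxe].
apply/eqP; rewrite eq_le xy /= leNgt; apply/negP => ltxy.
have := he _ (phase_timeB py px); rewrite subr_gt0 => /(_ ltxy).
by rewrite leNgt yxe.
Qed.

End PhaseTimes.

(** * A time with positive rate for all L at once *)

Section GenericTime.
Local Open Scope classical_set_scope.
Context {R : realType}.

(** The interval has positive Lebesgue measure and a countable set has measure 0. *)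
Lemma avoid_countable (A : set R) delta : 0 < delta -> countable A ->
  exists tau, 0 < tau < delta /\ ~ A tau.
Proof.
move=> d0 cA; apply: contrapT => h.
have sub : `]0, delta[ `<=` A.
  move=> t; rewrite /= in_itv /= => td; apply: contrapT => nA; apply: h.
  by exists t.
have := countable_lebesgue_measure0 (sub_countable (subset_card_le sub) cA).
rewrite lebesgue_measure_itv /= lte_fin d0 sube0 => /eqP.
by rewrite eqe gt_eqF.
Qed.

End GenericTime.

Section PositiveRate.
Local Open Scope classical_set_scope.
Context {R : realType} {D d m : nat} (s : 'I_m -> lattice D).
Context (h0 : 'M[R[i]]_(hdim d 'I_m)) (psi : 'cV[R[i]]_d).
Hypothesis psi1 : vnorm psi = 1.
Hypothesis h0_herm : h0 \is hermsymmx.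

(** The time is chosen before L, so the phase times of all tori are avoided together; elsewhere the
    overlap is below 1 by [overlap_eq1]. *)
Lemma positive_rate_time delta : 0 < delta ->
  exists tau : R, 0 < tau < delta /\
  forall L, fits L s ->
    ~ is_eigenstate (hamiltonian L s h0) (product_state (T := torus D L) psi) ->
    forall x : torus D L,
    (0 < local_rate (hamiltonian L s h0) (product_state (T := torus D L) psi) x tau)%E.
Proof.
move=> d0.
pose good L := fits L s /\
  ~ is_eigenstate (hamiltonian L s h0) (product_state (T := torus D L) psi).
pose A L := [set t : R | good L /\ 0 < t /\
  phase_time (evolution (hamiltonian L s h0)) (product_state (T := torus D L) psi) t].
have [tau [taud nA]] : exists tau, 0 < tau < delta /\ ~ (\bigcup_L A L) tau.
  apply: avoid_countable d0 _; apply: bigcup_countable => // L _.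
  have [[fL nL]|ng] := pselect (good L); last first.
    by rewrite (_ : A L = set0) //; apply/seteqP; split=> // t [].
  have ev := hamiltonian_evol h0_herm fL.
  have cnt := phase_times_countable ev (vnorm_product_state psi1 _) nL.
  by apply: sub_countable cnt; apply: subset_card_le => t [].
exists tau; split=> // L fL nL x; rewrite (local_rate_overlap s h0 psi1).
rewrite oppe_gt0 lne_lt0 lte_fin ltNge; apply/negP => ov1; apply: nA.
exists L => //; split=> //; split; first by case/andP: taud.
by have [a ha] := overlap_eq1 psi1 h0_herm fL ov1; exists a.
Qed.

End PositiveRate.

(** * Localization of a Heisenberg observable in a box *)

Section Box.
Local Open Scope complex_scope. Local Open Scope ring_scope.
Local Open Scope sesquilinear_scope.
Local Notation shift := Defs.shift.
Context {R : realType} {D d m : nat} (s : 'I_m -> lattice D).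
Local Notation C := R[i].
Context (h0 : 'M[C]_(hdim d 'I_m)) (psi : 'cV[C]_d).
Hypothesis psi1 : vnorm psi = 1.
Hypothesis h0_herm : h0 \is hermsymmx.
Hypothesis s_inj : injective s.

Local Notation H L := (hamiltonian L s h0).

(** The side has [w.+1] sites, and a box exists independently of any torus. *)
Definition box w := {ffun 'I_D -> 'I_w.+1}.
Definition box_site w (v : box w) : lattice D := [ffun j => Posz (v j)].
Definition box_emb L w (y : torus D L) (v : box w) : torus D L := shift y (box_site v).
Definition box_inside w (v : box w) : bool :=
  [forall i : 'I_m, forall j : 'I_D,
     (0 <= box_site v j + s i j) && (box_site v j + s i j <= w%:Z)].
(** Under [box_inside] no coordinate leaves the range of [inord], and these are the intended
    sites. *)
Definition box_term w (v : box w) (i : 'I_m) : box w :=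
  [ffun j => inord (absz (box_site v j + s i j))].
Definition box_center w : box w := [ffun=> inord w./2].
(* Only the terms inside the box are kept, so nothing here depends on [L]. *)
Definition box_hamiltonian w :=
  \sum_(v : box w | box_inside v) emb (d := d) (box_term v) h0.

Lemma box_site_term w (v : box w) i : box_inside v ->
  box_site (box_term v i) = box_site v + s i.
Proof.
move=> /forallP/(_ i)/forallP h; apply/ffunP => j; have /andP[l u] := h j.
rewrite !ffunE in l u *; rewrite inordK ?gez0_abs//.
by rewrite ltnS -lez_nat gez0_abs.
Qed.

Lemma box_term_inj w (v : box w) : box_inside v -> injective (box_term v).
Proof.
move=> vi i j e; apply: s_inj; apply: (@addrI _ (box_site v)).
by rewrite -!box_site_term// e.
Qed.

Lemma box_emb_inj L w (y : torus D L) : (w < L)%N -> injective (@box_emb L w y).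
Proof.
move=> wL u v /ffunP uv; apply/ffunP => j; apply: val_inj.
have L0 : (0 < L)%N by exact: leq_ltn_trans wL.
have kL (k : 'I_w.+1) : (k < L)%N by apply: leq_trans (ltn_ord k) _.
have := uv j; rewrite !shiftE !ffunE => /addrI /(congr1 (@nat_of_ord _)).
by rewrite !mulz_Zp1.
Qed.

Lemma box_emb_term L w (y : torus D L) (v : box w) i : box_inside v ->
  box_emb y (box_term v i) = term_sites s (box_emb y v) i.
Proof. by move=> vi; rewrite /box_emb /term_sites shiftD box_site_term. Qed.

Definition box_image L w (y : torus D L) : pred (torus D L) :=
  [pred z | [exists v : box w, box_inside v && (box_emb y v == z)]].

Lemma emb_box_hamiltonian L w (y : torus D L) : (w < L)%N ->
  emb (@box_emb L w y) (box_hamiltonian w) =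
  \sum_(z | box_image w y z) emb (term_sites s z) h0.
Proof.
move=> wL; have eI := box_emb_inj (y := y) wL.
rewrite emb_sum; transitivity
  (\sum_(z in (@box_emb L w y) @: [pred v | box_inside v])
     emb (d := d) (term_sites s z) h0).
  rewrite big_imset; last by move=> ? ? _ _; exact: eI.
  apply: eq_bigr => v vi; rewrite emb_comp//; last exact: box_term_inj.
  by apply: eq_emb => i; rewrite /= box_emb_term.
apply: eq_bigl => z; apply/imsetP/existsP => [[v vi ->]|[v /andP[vi /eqP <-]]].
  by exists v; rewrite eqxx andbT.
by exists v.
Qed.

Lemma box_hamiltonian_herm w : box_hamiltonian w \is hermsymmx.
Proof. by apply: herm_sum => v; exact: emb_herm. Qed.

(** Being supported on the box makes products over disjoint boxes factorize; being independent of L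
    and of the position makes the factors equal. *)
Definition box_observable w tau :=
  heis (evolution (box_hamiltonian w)) (site_proj psi (box_center w)) tau.

Context (rho0 : nat) (c : R).
Hypothesis rho0_gt0 : (0 < rho0)%N.
Hypothesis s_bound : forall i l, (absz (s i l) <= rho0)%N.
Hypothesis s_diam : forall i j l, (absz (s i l - s j l) <= rho0)%N.
Hypothesis c_gt0 : 0 < c.
Hypothesis h0_bound : opb h0 c.

Section Torus.
Context {L : nat} (fL : fits L s).
Implicit Types x y z : torus D L.

Definition terms_meet z z' := [exists i, exists j, term_sites s z i == term_sites s z' j].

Lemma terms_meetP z z' :
  reflect (exists i j, term_sites s z i = term_sites s z' j) (terms_meet z z').
Proof.
apply: (iffP existsP) => [[i /existsP[j /eqP e]]|[i [j e]]]; first by exists i, j.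
by exists i; apply/existsP; exists j; apply/eqP.
Qed.

(** A term meeting that of [z] is determined by the pair of indices of a common site. *)
Lemma terms_meet_degree z : (#|[pred z' | terms_meet z z']| <= m * m)%N.
Proof.
pose f (p : 'I_m * 'I_m) := shift (term_sites s z p.1) (- s p.2).
apply: leq_trans (_ : #|codom f| <= _)%N.
  apply: subset_leq_card; apply/fintype.subsetP => z' /terms_meetP[i [j e]].
  by apply/codomP; exists (i, j); rewrite /f /= e /term_sites shiftK.
by apply: leq_trans (leq_image_card _ _) _; rewrite card_prod !card_ord.
Qed.

(** Closeness to x is expressed by short lattice vectors, which avoids a distance on the torus. One
    link of the overlap relation accounts for a displacement of at most [rho0]; at k = 0 the
    condition is vacuous. *)
Definition far_from x (k : nat) : pred (torus D L) := fun z =>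
  `[< forall j (v : lattice D) i, (j < k)%N -> (forall l, absz (v l) <= rho0 * j)%N ->
        term_sites s z i <> shift x v >].

Lemma far_fromS x k z z' : far_from x k.+1 z -> terms_meet z z' -> far_from x k z'.
Proof.
move=> /asboolP fz /terms_meetP[a [b e]]; apply/asboolP => j v i jk vj zi.
apply: (fz j.+1 (v + s b - s i) a jk) => [l|].
  have -> : (v + s b - s i) l = v l + (s b l - s i l) by rewrite !ffunE addrA.
  have := vj l; have := s_diam b i l; rewrite mulnS.
  move: (rho0 * j)%N (s b l - s i l) (v l) => p q r; lia.
rewrite e -!shiftD -zi /term_sites !shiftD; congr (shift _ _).
by rewrite addrC subrK.
Qed.

Lemma term_bound z : opb (emb (d := d) (term_sites s z) h0) c.
Proof. by apply: opb_emb => //; exact: fits_inj fL z. Qed.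

Lemma term_herm z : emb (d := d) (term_sites s z) h0 \is hermsymmx.
Proof. exact: emb_herm. Qed.

Lemma term_comm z z' : ~~ terms_meet z z' ->
  comm (emb (term_sites s z') h0) (emb (d := d) (term_sites s z) h0) = 0.
Proof.
move=> nm; rewrite /comm emb_commute ?subrr//; try exact: (fits_inj fL).
move=> i j; apply/eqP => e; move/negP: nm; apply; apply/terms_meetP.
by exists j, i.
Qed.

Lemma site_comm x j z : far_from x j.+1 z ->
  comm (site_proj psi x) (emb (term_sites s z) h0) = 0.
Proof.
move=> /asboolP fz; rewrite /comm /site_proj emb_commute ?subrr//.
- exact: at_site_inj.
- exact: (fits_inj fL).
move=> i k; apply/eqP => e; apply: (fz 0%N 0 k) => // [l|].
  by rewrite ffunE.
by rewrite shift0.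
Qed.

(** If some site of the term were within [rho0 * j] of the centre, with j below the quotient, all
    its sites would be within [rho0 * j.+1], hence within w/2, and the term would lie in the box. *)
Lemma outside_far w y z : (w < L)%N -> ~~ box_image w y z ->
  far_from (box_emb y (box_center w)) (w./2 %/ rho0) z.
Proof.
move=> wL nz; apply/asboolP => j v i jk vj zi; move/negP: nz; apply.
set ce := box_center w in zi.
have small l : (absz (v l) + rho0 <= w./2)%N.
  apply: leq_trans (_ : rho0 * j.+1 <= _)%N.
    by rewrite mulnS addnC leq_add2l.
  by apply: leq_trans (leq_mul (leqnn _) jk) _; rewrite mulnC leq_trunc_div.
have hw : (w./2 + w./2 <= w)%N by rewrite addnn -[leqRHS]odd_double_half leq_addl.
have ceE l : box_site ce l = (w./2)%:Z.
  rewrite /box_site /ce !ffunE inordK// ltnS.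
  exact: leq_trans (leq_addr _ _) hw.
pose u : box w := [ffun l => inord (absz (box_site ce l + v l - s i l)%R)].
have E l : (box_site ce + v - s i) l = box_site ce l + v l - s i l by rewrite !ffunE.
have uE : box_site u = box_site ce + v - s i.
  apply/ffunP => l.
  rewrite E; have : 0 <= box_site ce l + v l - s i l <= w%:Z.
    have := small l; have := s_bound i l; rewrite ceE; lia.
  rewrite [box_site u l]ffunE /u [X in _ -> Posz (val X) = _]ffunE.
  move: (_ - s i l) => q q01; rewrite /= inordK; lia.
apply/existsP; exists u; apply/andP; split.
  apply/forallP => a; apply/forallP => l; rewrite uE E ceE.
  have := small l; have := s_diam i a l; lia.
apply/eqP; rewrite /box_emb uE -!shiftD -/(box_emb y ce) -zi.
by rewrite /term_sites shiftK.
Qed.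

(** In Duhamel's formula only terms missing from the box Hamiltonian occur. Those not touching the
    box commute with the observable exactly; the others are far from the centre. The prefactor is
    therefore a box volume and not [L ^ D]. *)
Lemma box_localization w y theta tau : (w < L)%N -> 0 < theta <= 1 -> 0 <= tau ->
  opb (heis (evolution (H L)) (site_proj psi (box_emb y (box_center w))) tau
       - emb (@box_emb L w y) (box_observable w tau))
    ((m * w.+1 ^ D)%:R * (4 * c * expR (2 * c * (m * m)%:R / theta * tau)
        * theta ^+ (w./2 %/ rho0)) * tau).
Proof.
move=> wL th tau0; have eI := box_emb_inj (y := y) wL.
set x := box_emb y (box_center w); set K := (w./2 %/ rho0)%N.
set c' := 4 * c * _ * _.
have evb := evolution_is_evol (box_hamiltonian_herm w).
have ev := hamiltonian_evol h0_herm fL.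
have ev' := emb_is_evol eI evb.
set V' := fun t => emb _ _ in ev'.
have -> : emb (@box_emb L w y) (box_observable w tau) = heis V' (site_proj psi x) tau.
  by rewrite /box_observable (emb_heis eI) (emb_site_proj _ _ eI).
have c'0 : 0 <= c'.
  case/andP: (th) => /ltW th0 _; rewrite /c' mulr_ge0 ?exprn_ge0//.
  by rewrite mulr_ge0 ?expR_ge0// mulr_ge0// ltW.
apply: (heis_perturbation ev ev') => //; first exact: opb_site_proj.
  by rewrite mulr_ge0.
move=> t t01.
have ev'' : is_evol (\sum_(z | box_image w y z) emb (term_sites s z) h0) V'.
  by rewrite -emb_box_hamiltonian.
have LR z : far_from x K z ->
    opb (comm (heis V' (site_proj psi x) t) (emb (term_sites s z) h0)) c'.
  move=> fz; apply: (lieb_robinson (ov := terms_meet) (far := far_from x) c_gt0 term_herm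
    term_bound term_comm terms_meet_degree _ (@far_fromS x) _ (@site_comm x) ev'') => //.
    by move=> z'; apply/asboolP.
  exact: opb_site_proj.
have -> : H L - emb (@box_emb L w y) (box_hamiltonian w) =
    \sum_(z | ~~ box_image w y z) emb (d := d) (term_sites s z) h0.
  rewrite emb_box_hamiltonian// hamiltonianE (bigID (box_image w y) xpredT) /=.
  by rewrite addrAC subrr add0r.
rewrite comm_suml.
pose touch := [pred z | [exists i, term_sites s z i \in codom (@box_emb L w y)]].
apply: (@opb_le _ _ _ (\sum_(z | ~~ box_image w y z) (if touch z then c' else 0))).
  apply: opb_sum => z nz; case: ifPn => [_|nt].
    by rewrite commC; apply: opbN; apply: LR; exact: outside_far.
  rewrite /x -(emb_site_proj _ _ eI) /V' -(emb_heis eI) /comm emb_commute //.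
  - by rewrite subrr; exact: opb0.
  - exact: fits_inj fL z.
  move=> i v; apply/eqP => e; move/negP: nt; apply; apply/existsP; exists i.
  by rewrite [term_sites s z i]e codom_f.
rewrite -big_mkcondr /=.
have -> : \sum_(z | ~~ box_image w y z && touch z) c' =
    c' *+ #|[pred z | ~~ box_image w y z && touch z]|.
  by rewrite -sumr_const; apply: eq_bigl.
rewrite -mulr_natl ler_wpM2r// ler_nat.
(* A touching term is determined by which of its sites falls on which site of the box. *)
pose f (p : 'I_m * box w) := shift (box_emb y p.2) (- s p.1).
apply: leq_trans (_ : #|codom f| <= _)%N.
  apply: subset_leq_card; apply/fintype.subsetP => z /andP[_ /existsP[i /codomP[v e]]].
  by apply/codomP; exists (i, v); rewrite /f /= -e /term_sites shiftK.
by apply: leq_trans (leq_image_card _ _) _; rewrite card_prod card_ffun !card_ord.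
Qed.


End Torus.

End Box.

(** * Ordered products of contractions and of projections *)

Section OperatorProducts.
Local Open Scope complex_scope. Local Open Scope ring_scope.
Local Open Scope sesquilinear_scope.
Context {R : realType} {n : nat} {I : eqType}.
Local Notation C := R[i].
Local Notation normc := Normc.normc.
Implicit Types (A B : I -> 'M[C]_n) (r : seq I).

Definition mxprod A r : 'M[C]_n := foldr (fun i M => A i *m M) 1%:M r.

Lemma opb_mxprod A r : (forall i, opb (A i) 1) -> opb (mxprod A r) 1.
Proof.
move=> A1; elim: r => [|i r IH] /=; first exact: opb1.
rewrite -[X in opb _ X]mul1r; exact: opbM.
Qed.

(** Factors are exchanged one at a time; the remaining ones are contractions, so the errors add. *)
Lemma opb_mxprodB A B r e : (forall i, opb (A i) 1) -> (forall i, opb (B i) 1) ->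
  (forall i, opb (A i - B i) e) -> opb (mxprod A r - mxprod B r) ((size r)%:R * e).
Proof.
move=> A1 B1 AB; elim: r => [|i r IH] /=; first by rewrite subrr mul0r; apply: opb0.
rewrite (_ : _ - _ = (A i - B i) *m mxprod A r + B i *m (mxprod A r - mxprod B r)).
  rewrite -nat1r mulrDl; apply: opbD.
    by have := opbM (AB i) (opb_mxprod r A1); rewrite mulr1 mul1r.
  by have := opbM (B1 i) IH; rewrite mul1r.
by rewrite mulmxBl mulmxBr addrA subrK.
Qed.

Lemma heis_mxprod (H : 'M[C]_n) V A r t : is_evol H V ->
  heis V (mxprod A r) t = mxprod (fun i => heis V (A i) t) r.
Proof.
move=> hV; elim: r => [|i r IH] /=.
  by rewrite /heis mulmx1 (evol_inv _ hV).
rewrite -IH /heis -!mulmxA; congr (_ *m (_ *m _)).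
by rewrite !mulmxA -(evolD hV) subrr (evol0 hV) mul1mx.
Qed.

Lemma commute_mxprod A r (M : 'M[C]_n) :
  (forall i, i \in r -> M *m A i = A i *m M) -> M *m mxprod A r = mxprod A r *m M.
Proof.
elim: r => [|i r IH] h /=; first by rewrite mul1mx mulmx1.
rewrite mulmxA h ?mem_head// -!mulmxA IH// => j jr.
by apply: h; rewrite inE jr orbT.
Qed.

Lemma mxprod_proj A r : uniq r ->
  (forall i, (A i)^t* = A i) -> (forall i, A i *m A i = A i) ->
  (forall i j, i != j -> A i *m A j = A j *m A i) ->
  (mxprod A r)^t* = mxprod A r /\ mxprod A r *m mxprod A r = mxprod A r.
Proof.
move=> ur Aa AA Ac; elim: r ur => [|i r IH] /=.
  by rewrite trmx1 map_mx1 mulmx1.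
move=> /andP[ir /IH[Ta TT]].
have cT : A i *m mxprod A r = mxprod A r *m A i.
  apply: commute_mxprod => j jr; apply: Ac; apply: contraNneq ir => ->.
  exact: jr.
split; first by rewrite trmx_mul map_mxM Ta Aa cT.
by rewrite mulmxA -(mulmxA (A i)) -cT mulmxA AA -mulmxA TT.
Qed.

Lemma mxprod_fix A r k (v : 'M[C]_(n, k)) :
  (forall i, A i *m v = v) -> mxprod A r *m v = v.
Proof.
move=> h; elim: r => [|i r IH] /=; first by rewrite mul1mx.
by rewrite -mulmxA IH h.
Qed.

(* The commuting projections [A i] all fix [v], so their product dominates the
   projection onto the line of [v]. *)
Lemma fidelity_le_mxprod (H : 'M[C]_n) V A r (v : 'cV[C]_n) t : is_evol H V -> uniq r ->
  vnorm v = 1 ->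
  (forall i, (A i)^t* = A i) -> (forall i, A i *m A i = A i) ->
  (forall i j, i != j -> A i *m A j = A j *m A i) ->
  (forall i, A i *m v = v) ->
  normc (dot v (V t *m v)) ^+ 2 <=
  normc (dot v (mxprod (fun i => heis V (A i) t) r *m v)).
Proof.
move=> hV ur v1 Aa AA Ac Av.
have [Ta TT] := mxprod_proj ur Aa AA Ac.
rewrite -(heis_mxprod _ _ _ hV) /heis -!mulmxA [in leRHS]dot_adj (evol_adj hV) opprK.
rewrite (proj_dot _ Ta TT).
have -> : normc ((vnorm (mxprod A r *m (V t *m v)) ^+ 2)%:C) =
    vnorm (mxprod A r *m (V t *m v)) ^+ 2.
  by rewrite /= expr0n addr0 sqrtr_sqr ger0_norm ?sqr_ge0.
rewrite ler_pXn2r ?nnegrE ?vnorm_ge0 ?normc_ge0//.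
rewrite -{1}(mxprod_fix r Av) -{1}Ta -dot_adj.
by apply: le_trans (cauchy_schwarz _ _) _; rewrite v1 mul1r.
Qed.

End OperatorProducts.

(** The scalar counterpart of [opb_mxprodB]. *)
Lemma ler_exprn_perturb {R : realType} (a p e : R) k : 0 <= a <= 1 -> 0 <= p <= 1 -> 0 <= e ->
  a <= p + e -> a ^+ k <= p ^+ k + k%:R * e.
Proof.
move=> /andP[a0 a1] /andP[p0 p1] e0 ape.
elim: k => [|k IH]; first by rewrite !expr0 mul0r addr0.
rewrite exprS; apply: le_trans (ler_wpM2l a0 IH) _.
rewrite mulrDr -nat1r (mulrDl 1) mul1r addrA; apply: lerD; last first.
  by rewrite ler_piMl// mulr_ge0.
apply: le_trans (ler_wpM2r (exprn_ge0 k p0) ape) _.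
by rewrite mulrDl -exprS lerD2l ler_piMr// exprn_ile1.
Qed.

(** * Fidelity and disjoint boxes *)

Section Packing.
Local Open Scope complex_scope. Local Open Scope ring_scope.
Local Open Scope sesquilinear_scope.
Local Notation shift := Defs.shift.
Context {R : realType} {D d m : nat} (s : 'I_m -> lattice D).
Local Notation C := R[i].
Local Notation normc := Normc.normc.
Context (h0 : 'M[C]_(hdim d 'I_m)) (psi : 'cV[C]_d).
Hypothesis psi1 : vnorm psi = 1.
Hypothesis h0_herm : h0 \is hermsymmx.

Local Notation H L := (hamiltonian L s h0).
Local Notation Psi T := (product_state (T := T) psi).

(** What the overlap becomes when the rest of the lattice is cut off; it does not involve L. *)
Definition box_overlap w tau : C :=
  dot (Psi (@box D w)) (box_observable s h0 psi w tau *m Psi (@box D w)).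

Lemma opb_box_observable w tau : opb (box_observable s h0 psi w tau) 1.
Proof.
apply: (opb_heis _ (evolution_is_evol (box_hamiltonian_herm s h0_herm w))).
exact: opb_site_proj.
Qed.

Lemma box_overlap_le1 w tau : normc (box_overlap w tau) <= 1.
Proof.
have := opb_dot (Psi (@box D w)) (Psi (@box D w)) (opb_box_observable w tau).
by rewrite !(vnorm_product_state psi1) !mulr1.
Qed.

Context {L w : nat} (fL : fits L s) (wL : (w < L)%N) (tau eps : R).
Hypothesis box_loc : forall y : torus D L,
  opb (heis (evolution (H L)) (site_proj psi (box_emb y (@box_center D w))) tau
       - emb (@box_emb D L w y) (box_observable s h0 psi w tau)) eps.

Lemma overlap_box (x : torus D L) :
  normc ((overlap s h0 psi x tau)%:C - box_overlap w tau) <= eps.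
Proof.
(* By translation invariance any corner of the box will do, and x is at hand. *)
set y := x : torus D L.
rewrite (overlap_translation psi1 h0_herm x (box_emb y (@box_center D w)) tau fL).
rewrite (overlap_heis psi1 h0_herm) // /box_overlap.
rewrite -(dot_emb psi1 _ (box_emb_inj (y := y) wL)) -dotBr -mulmxBl.
have := opb_dot (Psi (torus D L)) (Psi (torus D L)) (box_loc y).
by rewrite !(vnorm_product_state psi1) !mulr1.
Qed.

Definition packing := {ffun 'I_D -> 'I_(L %/ w.+1)}.

Definition corner (u : packing) : torus D L := shift 0 [ffun j => Posz (w.+1 * u j)].

Lemma box_emb_corner (u : packing) (v : @box D w) j :
  nat_of_ord (box_emb (corner u) v j) = (w.+1 * u j + v j)%N.
Proof.
rewrite /box_emb shiftD shiftE !ffunE add0r -PoszD mulz_Zp1//.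
  exact: leq_ltn_trans wL.
apply: leq_trans (leq_trunc_div L w.+1).
apply: leq_trans (_ : w.+1 * (u j).+1 <= _)%N.
  by rewrite mulnS addnC ltn_add2r.
by rewrite mulnC leq_mul2r ltn_ord orbT.
Qed.

Lemma packing_disjoint (u u' : packing) (v v' : @box D w) : u != u' ->
  box_emb (corner u) v != box_emb (corner u') v'.
Proof.
move=> uu'; apply/eqP => e; case/eqP: uu'; apply/ffunP => j; apply: val_inj => /=.
have : (w.+1 * u j + v j)%N = (w.+1 * u' j + v' j)%N by rewrite -!box_emb_corner e.
have E a (k : 'I_w.+1) : ((w.+1 * a + k) %/ w.+1 = a)%N.
  by rewrite mulnC divnMDl// divn_small ?addn0.
by move/(congr1 (divn^~ w.+1)); rewrite /= !E.
Qed.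

(** The factor 2 counts two replacements, each costing [eps] per box: Heisenberg projections by box
    observables, then the box overlap by the overlap itself. *)
Lemma fidelity_box_bound (x : torus D L) :
  fidelity (H L) (Psi (torus D L)) tau ^+ 2 <=
  overlap s h0 psi x tau ^+ ((L %/ w.+1) ^ D) + 2 * ((L %/ w.+1) ^ D)%:R * eps.
Proof.
have ev := hamiltonian_evol h0_herm fL.
have eps0 : 0 <= eps := opb_ge0 (box_loc x).
pose site (u : packing) : torus D L := box_emb (corner u) (@box_center D w).
pose A u := heis (evolution (H L)) (site_proj psi (site u)) tau.
pose B u := emb (@box_emb D L w (corner u)) (box_observable s h0 psi w tau).
pose r := enum {: packing}.
have nE : size r = ((L %/ w.+1) ^ D)%N.
  by rewrite /r -cardE card_ffun !card_ord.
have eI (u : packing) := box_emb_inj (y := corner u) wL.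
have A1 u : opb (A u) 1 by exact: opb_heis _ ev (opb_site_proj psi1 _).
have B1 u : opb (B u) 1 by exact: opb_emb (eI u) _ _ (opb_box_observable w tau).
have /= F1 := fidelity_le_mxprod tau ev (enum_uniq packing)
  (vnorm_product_state psi1 (torus D L))
  (fun u => site_proj_adj psi (site u)) (fun u => site_proj_idem psi1 (site u)).
have {}F1 : fidelity (H L) (Psi (torus D L)) tau ^+ 2 <=
    normc (dot (Psi (torus D L)) (mxprod A r *m Psi (torus D L))).
  rewrite /fidelity /bracket -mulmxA; apply: F1 => [u u' uu'|u].
    rewrite /site_proj emb_commute//; try exact: at_site_inj.
    by move=> i j; apply: packing_disjoint.
  exact: site_projPsi.
apply: le_trans F1 _; rewrite -nE.
have AB : opb (mxprod A r - mxprod B r) ((size r)%:R * eps).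
  by apply: opb_mxprodB => // u; exact: box_loc.
have prodB (t : seq packing) : uniq t ->
    dot (Psi (torus D L)) (mxprod B t *m Psi (torus D L)) = box_overlap w tau ^+ size t.
  elim: t => [|u t IH] /=; first by rewrite mul1mx dot_product_state.
  move=> /andP[ut /IH E]; rewrite (factorize psi1 _ (eI u)) ?E ?exprS//.
  apply: commute_mxprod => u' u't; apply: emb_commute; try exact: eI.
  by move=> v v'; apply: packing_disjoint; apply: contraNneq ut => ->.
have -> : mxprod A r = (mxprod A r - mxprod B r) + mxprod B r by rewrite subrK.
rewrite mulmxDl dotDr; apply: le_trans (normc_leD _ _) _.
rewrite prodB ?enum_uniq// addrC mulr_natl mulr2n mulrDl addrA; apply: lerD; last first.
  have := opb_dot (Psi (torus D L)) (Psi (torus D L)) AB.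
  by rewrite !(vnorm_product_state psi1) !mulr1.
have -> : normc (box_overlap w tau ^+ size r) = normc (box_overlap w tau) ^+ size r.
  elim: (size r) => [|k IH]; first by rewrite !expr0 Normc.normc1.
  by rewrite !exprS Normc.normcM IH.
apply: ler_exprn_perturb => //.
- by rewrite normc_ge0 box_overlap_le1.
- by rewrite overlap_ge0 overlap_le1.
apply: le_trans (_ : overlap s h0 psi x tau +
  normc ((overlap s h0 psi x tau)%:C - box_overlap w tau) <= _).
  have p0 : 0 <= (overlap s h0 psi x tau)%:C by rewrite ler0c overlap_ge0.
  rewrite -lecR rcD !normcC -{1}(subKr (overlap s h0 psi x tau)%:C (box_overlap w tau)).
  by apply: le_trans (ler_normB _ _) _; rewrite (ger0_norm p0).
by rewrite lerD2l overlap_box.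
Qed.

End Packing.

(** * Optimization over the side of the boxes *)

Section RateBound.
Context {R : realType}.

Lemma exprn_le_expR (x : R) k : 0 <= x -> x ^+ k <= k`!%:R * expR x.
Proof.
move=> x0; case: k => [|k].
  by rewrite expr0 fact0 mul1r -[leLHS]expR0 ler_expR.
have f0 : (0 : R) < (k.+1)`!%:R by rewrite ltr0n fact_gt0.
rewrite mulrC -ler_pdivrMr//; apply: le_trans (expR_ge1Dxn k x0).
by rewrite lerDr.
Qed.

Lemma ln_geB (p : R) : 0 < p -> 1 - p <= - ln p.
Proof.
move=> p0; have := @le_ln1Dx R (p - 1).
by rewrite ltrBDr addNr addrC subrK => /(_ p0); lra.
Qed.

Lemma powR_rootK (X : R) D : 0 <= X -> (X `^ (1 + D%:R)^-1) ^+ D.+1 = X.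
Proof.
move=> X0; rewrite -powR_mulrn ?powR_ge0// -powRrM nat1r mulVf ?pnatr_eq0//.
by rewrite powRr1.
Qed.

(* [a w] is the overlap in a box of side [w + 1], which does not depend on [L].
   Either [a w + E w < 1] for some [w], and then the rate is bounded below
   uniformly in [L]; or the rate decays so fast that [L ^ D] times it stays
   bounded, and there is nothing to prove. *)
Lemma rate_bound (D rho : nat) (K : R) (a : nat -> R) (E : nat -> R) :
  (0 < D)%N -> (0 < rho)%N -> 0 <= K ->
  (forall w, E w = K * (w.+1 ^ D)%:R * expR (- (8 * rho%:R)) ^+ (w./2 %/ rho)) ->
  exists (C : R) (L0 : nat), 0 < C /\
    forall (L : nat) (p F2 : R), (L0 <= L)%N -> (0 < L)%N -> 0 < p < 1 -> F2 <= p ->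
      (forall w, (w < L)%N -> `|p - a w| <= E w) ->
      (forall w, (w < L)%N ->
         F2 <= p ^+ ((L %/ w.+1) ^ D) + 2 * ((L %/ w.+1) ^ D)%:R * E w) ->
      F2 <= C * expR (- (4%:R^-1 * (L%:R ^+ D * - ln p) `^ (1 + D%:R)^-1)).
Proof.
move=> D0 rho0 K0 EE.
(* The extra factor pays for the two roundings in [w./2 %/ rho], leaving the clean decay
   exp(-4w). *)
pose K1 := K * expR (8 * rho%:R).
have K10 : 0 <= K1 by rewrite mulr_ge0 ?expR_ge0.
have Ebound w : E w <= K1 * w.+1%:R ^+ D * expR (- (4 * w%:R)).
  rewrite EE /K1 natrX -expRM_natr.
  rewrite mulrAC -!mulrA ler_wpM2l// mulrC [leRHS]mulrCA ler_wpM2l ?exprn_ge0//.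
  rewrite -expRD ler_expR.
  set q := (w./2 %/ rho)%N.
  have wq : (w <= 2 * rho * q.+1)%N.
    have := ltn_ceil w./2 rho0; rewrite -/q => h.
    rewrite -(odd_double_half w) -muln2; case: (odd w); lia.
  have : (w%:R : R) <= 2 * rho%:R * (q%:R + 1).
    by rewrite natr1 -!natrM ler_nat.
  lra.
have Ege0 w : 0 <= E w by rewrite EE !mulr_ge0 ?exprn_ge0 ?expR_ge0.
have r_ge0 (X : R) : 0 <= X `^ (1 + D%:R)^-1 by exact: powR_ge0.
have [[w1 hw1]|nw] := pselect (exists w, a w + E w < 1); last first.
  have ge1 w : 1 <= a w + E w.
    by rewrite leNgt; apply/negP => h; apply: nw; exists w.
  (* [B] bounds L^D times the error of the largest box, w = L - 1. As 1 - p is at most twice that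
     error, L^D k <= 4B; so r <= 4 + 4B, and exp(1 + B) exp(-r/4) is at least 1. *)
  pose B := K1 * expR 4 * (2 * D)`!%:R.
  have B0 : 0 <= B by rewrite !mulr_ge0 ?expR_ge0.
  exists (expR (1 + B)), (Num.truncn (4 * B)).+1; split; first exact: expR_gt0.
  move=> L p F2 LL L0 /andP[p0 p1] Fp hloc _.
  have LR : 4 * B <= L%:R.
    by apply: le_trans (ltW (truncnS_gt _)) _; rewrite ler_nat.
  have L1 : (1 : R) <= L%:R by rewrite ler1n.
  have LE : L%:R ^+ D * E L.-1 <= B.
    apply: le_trans (ler_wpM2l (exprn_ge0 _ (ler0n _ _)) (Ebound _)) _.
    rewrite prednK// [leLHS](_ : _ = K1 * (L%:R ^+ (2 * D) * expR (- (4 * L.-1%:R)))).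
      rewrite /B -mulrA ler_wpM2l// mulrC.
      have -> : (L.-1%:R : R) = L%:R - 1 by rewrite -(prednK L0) -natr1 addrK.
      apply: le_trans (ler_wpM2l (expR_ge0 _) (exprn_le_expR (2 * D) (ler0n _ L))) _.
      rewrite mulrCA mulrC ler_wpM2r// -expRD ler_expR; lra.
    by rewrite mulnC exprM expr2; ring.
  have LDL : L%:R <= (L%:R ^+ D : R) by apply: ler_eXnr.
  have E4 : 4 * E L.-1 <= 1.
    have h : L%:R * (4 * E L.-1) <= 4 * B.
      rewrite mulrCA ler_wpM2l//; apply: le_trans LE.
      by rewrite ler_wpM2r.
    have := le_trans h LR; rewrite -{2}(mulr1 L%:R) ler_pM2l//.
    exact: lt_le_trans L1.
  have := hloc L.-1; rewrite prednK// => /(_ (leqnn _)).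
  rewrite ler_norml => /andP[h1 h2].
  have p2 : 1 - p <= 2 * E L.-1 by have := ge1 L.-1; lra.
  (* The choice of [L0] gave 4 E <= 1, which keeps p at least 1/2, so that -ln p is comparable to 1
     - p. *)
  have pinv : p^-1 <= 2.
    rewrite -[2]invrK lef_pV2 ?posrE ?invr_gt0//; lra.
  have kap : - ln p <= 4 * E L.-1.
    have := @ln_geB p^-1; rewrite invr_gt0 lnV ?posrE// opprK => /(_ p0) h.
    have : p^-1 - 1 <= 2 * (1 - p).
      have -> : p^-1 - 1 = p^-1 * (1 - p) by rewrite mulrBr mulr1 mulVf ?gt_eqF.
      by rewrite ler_wpM2r// subr_ge0 ltW.
    lra.
  set r := _ `^ _.
  have lnp : 0 <= - ln p by rewrite oppr_ge0 ln_le0// ltW.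
  have rX : r ^+ D.+1 <= 4 * B.
    rewrite powR_rootK ?mulr_ge0 ?exprn_ge0//.
    apply: le_trans (ler_wpM2l (exprn_ge0 _ (ler0n _ _)) kap) _.
    by rewrite mulrCA ler_wpM2l.
  have rB : r <= 4 + 4 * B.
    have [r1|r1] := leP r 1; first by lra.
    have : r <= r ^+ D.+1 by apply: ler_eXnr => //; exact: ltW.
    lra.
  apply: le_trans Fp _; apply: le_trans (ltW p1) _.
  rewrite -expRD -[leLHS]expR0 ler_expR; lra.
(* A lower bound for the rate, valid for every L above [w1]. *)
pose eta := 1 - (a w1 + E w1).
have eta0 : 0 < eta by rewrite subr_gt0.
(* Collects n <= r^(D+1)/eta, the error K1 r^D exp(8 - 2r) of one box, and r^(2D+1) <= (2D+1)!
   exp(r). *)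
pose K3 := 2 * K1 / eta * expR 8 * (2 * D).+1`!%:R.
have eta0' := ltW eta0.
have K30 : 0 <= K3 by rewrite /K3 !mulr_ge0 ?expR_ge0 ?invr_ge0.
exists (expR 1 + K3), w1.+1; split; first by rewrite ltr_wpDr ?expR_gt0.
move=> L p F2 LL L0 /andP[p0 p1] Fp hloc hF.
have e1 : 1 <= expR 1 :> R by rewrite -[leLHS]expR0 ler_expR.
set kap := - ln p.
have kap_eta : eta <= kap.
  apply: le_trans (ln_geB p0); rewrite /eta lerD2l lerNl opprK.
  have := hloc w1 LL; rewrite ler_norml => /andP[_ h]; lra.
have kap0 : 0 < kap by exact: lt_le_trans kap_eta.
have pE : p = expR (- kap) by rewrite opprK lnK.
set X := _ * kap; set r := _ `^ _.
have X0 : 0 <= X by rewrite mulr_ge0 ?exprn_ge0// ltW.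
have r0 : 0 <= r by exact: r_ge0.
have rX : r ^+ D.+1 = X by exact: powR_rootK.
have LR0 : (0 : R) < L%:R by rewrite ltr0n.
have Cge (y : R) : 1 <= y -> y <= expR 1 + K3 ->
    y * expR (- (4%:R^-1 * r)) <= (expR 1 + K3) * expR (- (4%:R^-1 * r)).
  by move=> _ h; rewrite ler_wpM2r ?expR_ge0.
(* When k >= L the wanted box might not fit in the torus, but then r <= k and the one-site bound F^2
   <= p = exp(-k) suffices. *)
have [Lk|kL] := leP L%:R kap.
  have rk : r <= kap.
    rewrite -(@ler_pXn2r _ D.+1) ?nnegrE// ?(ltW kap0)// rX /X exprSr ler_wpM2r ?(ltW kap0)//.
    by rewrite ler_pXn2r ?nnegrE// ltW.
  apply: le_trans Fp _; apply: le_trans (Cge 1 _ _) => //; last by lra.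
  rewrite mul1r pE ler_expR; lra.
have rL : r <= L%:R.
  rewrite -(@ler_pXn2r _ D.+1) ?nnegrE// rX /X exprSr ler_wpM2l ?exprn_ge0//.
  exact: ltW.
(* Below 2 the side r/2 would round to 0; there exp(1) exp(-r/4) already exceeds 1. *)
have [r2|r2] := ltP r 2.
  apply: le_trans Fp _; apply: le_trans (ltW p1) _.
  apply: le_trans (Cge (expR 1) _ _) => //; last by lra.
  rewrite -expRD -[leLHS]expR0 ler_expR; lra.
pose W := Num.truncn (r / 2).
have rh0 : 0 <= r / 2 by rewrite divr_ge0.
have /andP[W1 W2] := truncn_itv rh0; rewrite -/W -?[W.+1%:R]natr1 in W1 W2.
have W0 : (0 < W)%N.
  by rewrite /W truncn_gt0; lra.
pose w := W.-1.
have wW : w.+1 = W by rewrite prednK.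
have WR : (W%:R : R) <= L%:R by lra.
have wL : (w < L)%N by rewrite wW -(ler_nat R).
have [n nE] : exists n, n = ((L %/ W) ^ D)%N by exists ((L %/ W) ^ D)%N.
have := hF w wL; rewrite wW -nE => hFn.
clearbody w W r.
have WR0 : (0 : R) < W%:R by rewrite ltr0n.
have rp : 0 < r by exact: lt_le_trans r2.
(* With q boxes per direction L <= (q + 1) r/2, and r <= L turns this into L <= q r: halving the
   side pays for the rounding. *)
have qL : L%:R / r <= (L %/ W)%:R.
  have h1 : (L%:R : R) <= ((L %/ W)%:R + 1) * W%:R.
    by rewrite natr1 -natrM ler_nat ltnW// ltn_ceil.
  have h2 : ((L %/ W)%:R + 1) * W%:R <= ((L %/ W)%:R + 1) * (r / 2) :> R.
    by rewrite ler_wpM2l ?addr_ge0.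
  rewrite ler_pdivrMr//; lra.
(* This is where the exponent 1/(1+D) comes from: (L/r)^D k = r^(D+1)/r^D = r. *)
have nk : r <= n%:R * kap.
  have h : (L%:R / r) ^+ D <= n%:R.
    by rewrite nE natrX ler_pXn2r ?nnegrE ?divr_ge0.
  apply: le_trans (ler_wpM2r (ltW kap0) h).
  rewrite expr_div_n mulrAC -/X -rX exprS mulfK//.
  by rewrite expf_neq0// gt_eqF.
have pn : p ^+ n <= expR (- r).
  by rewrite pE -expRM_natl ler_expR mulrN lerN2.
have nL : (n%:R : R) <= r ^+ D.+1 / eta.
  rewrite ler_pdivlMr// rX /X; apply: ler_pM => //.
  by rewrite nE natrX ler_pXn2r ?nnegrE// ler_nat leq_div.
have Ew : E w <= K1 * r ^+ D * expR (8 - 2 * r).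
  apply: le_trans (Ebound w) _; rewrite wW; apply: ler_pM; rewrite ?mulr_ge0 ?exprn_ge0 ?expR_ge0//.
    by rewrite ler_wpM2l// ler_pXn2r ?nnegrE//; lra.
  have : (W%:R : R) = w%:R + 1 by rewrite -wW natr1.
  rewrite ler_expR; lra.
have err : 2 * n%:R * E w <= K3 * expR (- r).
  have -> : 2 * n%:R * E w = 2 * (n%:R * E w) by rewrite mulrA.
  have h := ler_pM (ler0n _ n) (Ege0 w) nL Ew.
  apply: le_trans (ler_wpM2l _ h) _ => //.
  have -> : 2 * (r ^+ D.+1 / eta * (K1 * r ^+ D * expR (8 - 2 * r))) =
     2 * K1 / eta * expR 8 * (r ^+ (2 * D).+1 * expR (- (2 * r))).
    by rewrite expRD exprS [in RHS]exprS mulnC exprM expr2; ring.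
  rewrite /K3 -[leRHS]mulrA ler_wpM2l ?mulr_ge0 ?expR_ge0 ?invr_ge0 ?(ltW eta0)//.
  apply: le_trans (ler_wpM2r (expR_ge0 _) (exprn_le_expR _ r0)) _.
  rewrite -mulrA -expRD ler_wpM2l// ler_expR; lra.
apply: le_trans hFn _; apply: le_trans (lerD pn err) _.
rewrite -{1}(mul1r (expR _)) -mulrDl; apply: ler_pM; rewrite ?addr_ge0 ?expR_ge0//.
  by rewrite lerD2r.
rewrite ler_expR; lra.
Qed.

End RateBound.

(** * The fidelity bound with constants independent of L *)

Section RateTheorem.
Local Open Scope complex_scope. Local Open Scope ring_scope.
Context {R : realType} {D d m : nat} (s : 'I_m -> lattice D).
Local Notation C := R[i].
Local Notation normc := Normc.normc.
Context (h0 : 'M[C]_(hdim d 'I_m)) (psi : 'cV[C]_d).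
Hypothesis psi1 : vnorm psi = 1.
Hypothesis h0_herm : h0 \is hermsymmx.

Local Notation H L := (hamiltonian L s h0).
Local Notation Psi L := (product_state (T := torus D L) psi).

(** The bound from a single site, for the regimes in which packing boxes gives nothing: rate at
    least L, small r, or zero overlap. *)
Lemma fidelity_le_overlap L (x : torus D L) t : fits L s ->
  fidelity (H L) (Psi L) t ^+ 2 <= overlap s h0 psi x t.
Proof.
move=> fL; rewrite /fidelity /bracket -mulmxA /overlap.
rewrite ler_pXn2r ?nnegrE ?vnorm_ge0 ?normc_ge0// -/(dot _ _).
have -> : dot (Psi L) (evolution (H L) t *m Psi L) =
    dot (Psi L) (site_proj psi x *m (evolution (H L) t *m Psi L)).
  by rewrite [RHS]dot_adj site_proj_adj site_projPsi.
by apply: le_trans (cauchy_schwarz _ _) _; rewrite (vnorm_product_state psi1) mul1r.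
Qed.

Lemma lattice_range : exists rho : nat, [/\ (0 < rho)%N,
  forall i l, (absz (s i l) <= rho)%N &
  forall i j l, (absz (s i l - s j l)%R <= rho)%N].
Proof.
pose M := (\sum_i \sum_l absz (s i l))%N.
have sM i l : (absz (s i l) <= M)%N.
  by rewrite /M (bigD1 i) //= (bigD1 l) //= -!addnA leq_addr.
exists (2 * M).+1; split=> // [i l|i j l]; first by have := sM i l; lia.
have := sM i l; have := sM j l; lia.
Qed.

Lemma fidelity_rate_bound tau : (0 < D)%N -> injective s -> 0 < tau ->
  exists (C : R) (L0 : nat), 0 < C /\
    forall L, (L0 <= L)%N -> fits L s -> forall x : torus D L,
      0 < overlap s h0 psi x tau < 1 ->
      fidelity (H L) (Psi L) tau ^+ 2 <=
      C * expR (- (4%:R^-1 *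
        (L%:R ^+ D * - ln (overlap s h0 psi x tau)) `^ (1 + D%:R)^-1)).
Proof.
move=> D0 sI tau0.
have [c c0 hc] := opb_exists h0.
have [rho [rho0 sb sd]] := lattice_range.
(* The depth of a box is about w/(2 rho) links, so this choice gives the decay exp(-4w); the
   resulting exp(2 c m^2 tau/theta) is a constant because tau is fixed. *)
set theta := expR (- (8 * rho%:R)) : R.
have th01 : 0 < theta <= 1.
  by rewrite expR_gt0 -[leRHS]expR0 ler_expR oppr_le0 mulr_ge0.
pose K := m%:R * (4 * c * expR (2 * c * (m * m)%:R / theta * tau)) * tau.
have K0 : 0 <= K by rewrite !mulr_ge0 ?expR_ge0// ltW.
pose E w := K * (w.+1 ^ D)%:R * theta ^+ (w./2 %/ rho).
have [C0 [L0 [C00 hC]]] := @rate_bound R D rho K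
  (fun w => complex.Re (box_overlap s h0 psi w tau)) E D0 rho0 K0 (fun w => erefl _).
exists C0, L0; split=> // L LL fL x pp.
have loc w (wL : (w < L)%N) (y : torus D L) :
    opb (heis (evolution (H L)) (site_proj psi (box_emb y (@box_center D w))) tau
       - emb (@box_emb D L w y) (box_observable s h0 psi w tau)) (E w).
  have := box_localization psi1 h0_herm sI rho0 sb sd c0 hc fL y wL th01 (ltW tau0).
  rewrite (_ : _ * tau = E w)// natrM /E /K; ring.
apply: hC => //; first by case: fL.
- exact: fidelity_le_overlap.
- move=> w wL; have := overlap_box psi1 h0_herm fL wL (loc w wL) x.
  apply: le_trans; rewrite -lecR; apply: le_trans _ (normc_ge_Re _).
  by case: (box_overlap _ _ _ _ _).
- by move=> w wL; have := fidelity_box_bound psi1 h0_herm fL wL (loc w wL) x.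
Qed.

End RateTheorem.

Theorem theorem5 (R : realType) (D d b m : nat) (h : R)
    (psi : 'cV[R[i]]_d)
    (s : 'I_m -> lattice D) (h0 : 'M[R[i]]_(hdim d 'I_m)) :
  (0 < D)%N ->
  vnorm psi = 1 ->
  (m <= b)%N -> injective s -> connected_cluster s ->
  h0 \is hermsymmx ->
  opnorm h0 <= h ->
  let H (L : nat) := hamiltonian L s h0 in
  let Psi (L : nat) := product_state (T := torus D L) psi in
  let k (L : nat) (x : torus D L) (t : R) := local_rate (H L) (Psi L) x t in
  let F (L : nat) (t : R) := fidelity (H L) (Psi L) t in
  (forall delta : R, 0 < delta ->
     exists tau : R, 0 < tau < delta /\
       forall L : nat, fits L s -> ~ is_eigenstate (H L) (Psi L) ->
       forall x : torus D L, (0 < k L x tau)%E)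
  /\
  (forall tau : R, 0 < tau ->
     exists (C : R) (L0 : nat), 0 < C /\
       forall L : nat, (L0 <= L)%N -> fits L s ->
       ~ is_eigenstate (H L) (Psi L) ->
       forall x : torus D L, (0 < k L x tau)%E ->
       ((F L tau ^+ 2)%:E <=
          C%:E * expeR (- ((4%:R^-1)%:E *
            poweR ((L%:R ^+ D)%:E * k L x tau) ((1 + D%:R)^-1))))%E).
Proof.
move=> D0 psi1 _ sI _ h0_herm _ H Psi k F; split.
  exact: positive_rate_time psi1 h0_herm.
move=> tau tau0.
have [C [L0 [C0 hC]]] := fidelity_rate_bound psi1 h0_herm D0 sI tau0.
exists C, L0; split=> // L LL fL _ x.
rewrite /k (local_rate_overlap s h0 psi1) => kpos.
have p1 : overlap s h0 psi x tau < 1 by move: kpos; rewrite oppe_gt0 lne_lt0 lte_fin.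
(* At zero overlap the rate is infinite, but the fidelity vanishes as well and nonnegativity of the
   right-hand side is enough. *)
have [p0|p0] := ltP 0 (overlap s h0 psi x tau); last first.
  apply: (@le_trans _ _ 0%E); last by rewrite mule_ge0 ?expeR_ge0 ?lee_fin ?ltW.
  by rewrite lee_fin; apply: le_trans p0; exact: fidelity_le_overlap.
rewrite lne_EFin//= lee_fin; apply: hC => //.
by rewrite p0.
Qed.
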